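(* In the setting described in the context, let $u\in V$ solve $a(u,v)=F(v)$ for all $v\in V$ with right-hand side $$F(v):=\int_\Omega G:D^m v\,dx+\int_\Omega g v\,dx+\sum_{a\in A}\beta(a)v(a)\quad(v\in V),$$ where $G\in L^2(\Omega;\mathbb R^{2^m})$, $g\in L^2(\Omega)$, $A$ is a finite set of interior vertices of $\mathcal T$, and $\beta(a)\in\mathbb R$ for $a\in A$. Then $$\|h_{\mathcal T}^mg\|_{L^2(\Omega)}\lesssim|\!|\!| u-I_{\mathrm{nc}}u|\!|\!|_{\mathrm{pw}}+\mathrm{osc}_m(g,\mathcal T)+\|G-\Pi_0G\|.$$
   Context: Let $m\in\mathbb N$ (the paper's examples are Crouzeix–Raviart, $m=1$, and Morley, $m=2$), let $\Omega\subset\mathbb R^2$ be a planar bounded Lipschitz domain with polygonal boundary, $V:=H^m_0(\Omega)$, and $a(v,w):=\int_\Omega D^m v:D^m w\,dx$ for $v,w\in V$. Write $\|\cdot\|:=\|\cdot\|_{L^2(\Omega)}$. Let $\mathcal T$ be a shape-regular triangulation of $\Omega$ into triangles, $P_k(\mathcal T)$ the space of piecewise polynomials of total degree at most $k$, $\Pi_k$ the $L^2$ projection onto $P_k(\mathcal T)$ (componentwise for tensor fields), $H^m(\mathcal T):=\{v\in L^2(\Omega): v|_T\in H^m(T)\ \forall T\in\mathcal T\}$, and $h_{\mathcal T}\in P_0(\mathcal T)$ with $h_{\mathcal T}|_T=\mathrm{diam}(T)$. Set $a_{\mathrm{pw}}(v,w):=\sum_{T\in\mathcal T}\int_T D^m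 v:D^m w\,dx$ for $v,w\in H^m(\mathcal T)$, $|\!|\!| v|\!|\!|_{\mathrm{pw}}:=a_{\mathrm{pw}}(v,v)^{1/2}$, and $\mathrm{osc}_m(g,\mathcal T):=\|h_{\mathcal T}^m(g-\Pi_mg)\|$. $V_{\mathrm{nc}}\subset P_m(\mathcal T)$ is a nontrivial linear subspace on which $|\!|\!|\cdot|\!|\!|_{\mathrm{pw}}$ is a norm. There are an interpolation operator $I_{\mathrm{nc}}:V\to V_{\mathrm{nc}}$ and a constant $\kappa_m>0$ with, for all $v\in V$ and $w_m\in P_m(\mathcal T)$: $a_{\mathrm{pw}}(v-I_{\mathrm{nc}}v,w_m)=0$ and $\|h_{\mathcal T}^{-m}(v-I_{\mathrm{nc}}v)\|\le\kappa_m|\!|\!| v-I_{\mathrm{nc}}v|\!|\!|_{\mathrm{pw}}$. Point forces: $A=\emptyset$ if $m=1$ (for $m\ge2$ point evaluation is bounded on $V$). Notation: $A_1\lesssim B_1$ means $A_1\le CB_1$ with a generic constant $C>0$ that depends only on $m$ and the shape-regularity of $\mathcal T$ (not on the mesh-size or the data). *)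

(* Defs.v *)
From HB Require Import structures.
From mathcomp Require Import all_boot all_order all_algebra finmap.
From mathcomp Require Import all_classical all_reals all_analysis.
Set Implicit Arguments.
Unset Strict Implicit.
Unset Printing Implicit Defensive.
Import Order.TTheory GRing.Theory Num.Theory.
Import numFieldNormedType.Exports.
Local Open Scope classical_set_scope.
Local Open Scope ring_scope.

(* Elements of L^2, H^m, ... are represented by functions on the whole plane,
   of which only the values almost everywhere on the domain matter. *)

Section Plane.
Context {R : realType}.

Definition leb2 : {measure set (measurableTypeR R * measurableTypeR R) -> \bar R} :=
  (@lebesgue_measure R \x @lebesgue_measure R)%E.

Definition L2 (U : set (R * R)) (f : R * R -> R) : Prop :=
  measurable_fun U f /\ finite_norm leb2 2%:E (f \_ U).

Definition L2norm (U : set (R * R)) (f : R * R -> R) : R :=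
  fine ('N[leb2]_2%:E [EFin \o (f \_ U)])%E.

(* The norm of R * R in the library is the maximum norm. *)
Definition edist (x y : R * R) : R :=
  Num.sqrt ((x.1 - y.1) ^+ 2 + (x.2 - y.2) ^+ 2).

Definition diam (K : set (R * R)) : R :=
  sup [set d | exists x y, [/\ K x, K y & d = edist x y]].

(* supremum of the diameters of the closed Euclidean discs contained in K *)
Definition indiam (K : set (R * R)) : R :=
  sup [set d | exists c r,
         [/\ 0 <= r, [set x | edist x c <= r] `<=` K & d = 2 * r]].

Definition bd (U : set (R * R)) : set (R * R) := closure U `\` U°.

(* the convex hull of the points V k, k in S *)
Definition hull (S : {set 'I_3}) (V : 'I_3 -> R * R) : set (R * R) :=
  [set x | exists l : 'I_3 -> R,
     [/\ forall k, 0 <= l k, \sum_(k in S) l k = 1,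
         x.1 = \sum_(k in S) l k * (V k).1 &
         x.2 = \sum_(k in S) l k * (V k).2]].

Definition triangle (V : 'I_3 -> R * R) : set (R * R) := hull [set: 'I_3]%SET V.

Definition segment (a b : R * R) : set (R * R) :=
  [set x | exists t, [/\ 0 <= t <= 1, x.1 = (1 - t) * a.1 + t * b.1 &
                         x.2 = (1 - t) * a.2 + t * b.2]].

(* Near each boundary point x, in the Cartesian frame with origin x and
   orthonormal axes e and (- e.2, e.1), U is the part of a square lying strictly
   above the graph of a Lipschitz function. *)
Definition lipschitz_boundary (U : set (R * R)) : Prop :=
  forall x, bd U x ->
  exists (e : R * R) (r : R) (gam : R -> R),
    [/\ e.1 ^+ 2 + e.2 ^+ 2 = 1, 0 < r, lipschitz gam &
        forall y,
          let s := (y.1 - x.1) * e.1 + (y.2 - x.2) * e.2 in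
          let t := (y.2 - x.2) * e.1 - (y.1 - x.1) * e.2 in
          `|s| < r -> `|t| < r -> (U y <-> gam s < t)].

Definition polygonal_boundary (U : set (R * R)) : Prop :=
  exists s : seq ((R * R) * (R * R)),
    bd U = [set x | exists2 ab, ab \in s & segment ab.1 ab.2 x].

Definition polygonal_lipschitz_domain (U : set (R * R)) : Prop :=
  [/\ open U, connected U, U !=set0, bounded_set U &
      lipschitz_boundary U /\ polygonal_boundary U].

End Plane.

Section Sobolev.
Context {R : realType}.
Implicit Types (U : set (R * R)) (v w f g phi : R * R -> R).

(* Directions of differentiation are booleans: false is x_1, true is x_2. *)
Definition pdir (b : bool) : R * R := if b then (0, 1) else (1, 0).

Definition pderivs (s : seq bool) (phi : R * R -> R) : R * R -> R :=
  foldr (fun b f x => 'D_(pdir b) f x) phi s.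

Definition smooth (phi : R * R -> R) : Prop :=
  forall s : seq bool, continuous (pderivs s phi) /\
    forall b x, derivable (pderivs s phi) x (pdir b).

(* C_c^oo(U) *)
Definition test_fun U phi : Prop :=
  smooth phi /\
  exists K, [/\ compact K, K `<=` U & forall x, ~ K x -> phi x = 0].

Definition is_wderiv U (s : seq bool) v g : Prop :=
  L2 U g /\
  forall phi, test_fun U phi ->
    \int[leb2]_(x in U) (v x * pderivs s phi x) =
    (-1) ^+ size s * \int[leb2]_(x in U) (g x * phi x).

(* A representative of the weak derivative (unique almost everywhere in U); the
   zero function when there is no weak derivative in L^2(U). *)
Definition wderiv U (s : seq bool) v : R * R -> R :=
  xget (fun=> 0) [set g | is_wderiv U s v g].

Definition Hspace (m : nat) U v : Prop :=
  L2 U v /\ forall s : seq bool, (size s <= m)%N -> exists g, is_wderiv U s v g.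

Definition Hnorm (m : nat) U v : R :=
  Num.sqrt (\sum_(k < m.+1) \sum_(s : k.-tuple bool)
              L2norm U (wderiv U s v) ^+ 2).

(* closure of C_c^oo(U) in H^m(U) *)
Definition H0space (m : nat) U v : Prop :=
  Hspace m U v /\
  forall eps : R, 0 < eps ->
    exists2 phi, test_fun U phi & Hnorm m U (v \- phi) < eps.

(* m-tensor fields in the plane: 2^m components *)
Definition tensor (m : nat) : Type := m.-tuple bool -> R * R -> R.

Definition ddot (m : nat) (X Y : tensor m) : R * R -> R :=
  fun x => \sum_(s : m.-tuple bool) X s x * Y s x.

Definition L2tensor (m : nat) U (X : tensor m) : Prop := forall s, L2 U (X s).

Definition L2normT (m : nat) U (X : tensor m) : R :=
  Num.sqrt (\sum_(s : m.-tuple bool) L2norm U (X s) ^+ 2).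

Definition Dm (m : nat) U v : tensor m := fun s => wderiv U s v.
Arguments Dm {m} U v s.

Definition aform (m : nat) U v w : R :=
  \int[leb2]_(x in U) @ddot m (Dm U v) (Dm U w) x.

(* Point evaluation of an L^2 class: the value at a of its representative that
   is continuous on the open set U.  That representative is unique; for
   v in H^m_0(U) with m >= 2 it exists by the Sobolev embedding theorem. *)
Definition is_ptval U v (a : R * R) (y : R) : Prop :=
  exists w, [/\ {in U, continuous w}, {ae leb2, forall x, U x -> v x = w x} &
                y = w a].

Definition ptval U v (a : R * R) : R := xget 0 [set y | is_ptval U v a y].

End Sobolev.

Section Triangulation.
Context {R : realType}.
Variable U : set (R * R).

(* [T i k] is the k-th vertex of the i-th triangle. *)
Context {n : nat}.
Variable T : 'I_n -> 'I_3 -> R * R.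

Definition tri (i : 'I_n) : set (R * R) := triangle (T i).

Definition nondegenerate (V : 'I_3 -> R * R) : Prop :=
  let p := V ord0 in let q := V (inord 1) in let r := V (inord 2) in
  (q.1 - p.1) * (r.2 - p.2) - (q.2 - p.2) * (r.1 - p.1) != 0.

(* The last condition says that two distinct triangles are disjoint or share
   exactly a vertex or exactly an edge ([hull set0 _] is empty). *)
Definition triangulation : Prop :=
  [/\ forall i, nondegenerate (T i),
      \bigcup_i tri i = closure U &
      forall i j, i != j -> exists S S' : {set 'I_3},
        [/\ (#|S| <= 2)%N, (#|S'| <= 2)%N,
            tri i `&` tri j = hull S (T i) & tri i `&` tri j = hull S' (T j)]].

Definition shape_regular (sigma : R) : Prop :=
  forall i, diam (tri i) <= sigma * indiam (tri i).

Definition interior_vertex (a : R * R) : Prop := U a /\ exists i k, a = T i k.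

(* The value on the skeleton, a null set, is irrelevant. *)
Definition meshsize (x : R * R) : R :=
  \sum_(i < n) diam (tri i) * \1_((tri i)°) x.

(* P_k(T) *)
Definition pwpoly (k : nat) (v : R * R -> R) : Prop :=
  L2 U v /\
  forall i, exists c : nat -> nat -> R,
    {ae leb2, forall x, tri i x ->
       v x = \sum_(p < k.+1) \sum_(q < k.+1 | (p + q <= k)%N)
               c p q * x.1 ^+ p * x.2 ^+ q}.

Definition is_L2proj (k : nat) (f p : R * R -> R) : Prop :=
  pwpoly k p /\
  forall q, pwpoly k q -> \int[leb2]_(x in U) ((f x - p x) * q x) = 0.

Definition L2proj (k : nat) (f : R * R -> R) : R * R -> R :=
  xget (fun=> 0) [set p | is_L2proj k f p].

Definition L2projT (m k : nat) (X : tensor m) : @tensor R m :=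
  fun s => L2proj k (X s).

(* Integration over the open triangles, where the weak derivatives live. *)
Definition apw (m : nat) (v w : R * R -> R) : R :=
  \sum_(i < n) aform m (tri i)° v w.

Definition normpw (m : nat) (v : R * R -> R) : R := Num.sqrt (apw m v v).

Definition osc (m : nat) (g : R * R -> R) : R :=
  L2norm U (fun x => meshsize x ^+ m * (g x - L2proj m g x)).

Definition nc_space (m : nat) (Vnc : set (R * R -> R)) : Prop :=
  [/\ Vnc `<=` [set v | pwpoly m v],
      Vnc (fun=> 0) /\
        (forall (c : R) v w, Vnc v -> Vnc w -> Vnc (fun x => c * v x + w x)),
      (exists2 v, Vnc v & ~ {ae leb2, forall x, U x -> v x = 0}) &
      (* normpw is a seminorm, so being a norm is definiteness *)
      forall v, Vnc v -> normpw m v = 0 -> {ae leb2, forall x, U x -> v x = 0}].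

Definition nc_interpolation (m : nat) (Vnc : set (R * R -> R)) (kappa : R)
    (Inc : (R * R -> R) -> (R * R -> R)) : Prop :=
  forall v, H0space m U v ->
    [/\ Vnc (Inc v),
        forall w, pwpoly m w -> apw m (v \- Inc v) w = 0 &
        L2norm U (fun x => meshsize x ^- m * (v x - Inc v x))
          <= kappa * normpw m (v \- Inc v)].

End Triangulation.

Section RightHandSide.
Context {R : realType}.

Definition rhs (U : set (R * R)) (m : nat) (G : tensor m) (g : R * R -> R)
    (A : {fset R * R}) (beta : R * R -> R) (v : R * R -> R) : R :=
  \int[leb2]_(x in U) ddot G (Dm U v) x + \int[leb2]_(x in U) (g x * v x)
  + \sum_(a <- A) beta a * ptval U v a.

End RightHandSide.

(* Main.v *)
Require Import Defs.
From HB Require Import structures.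
From mathcomp Require Import all_boot all_order all_algebra finmap.
From mathcomp Require Import all_classical all_reals all_analysis.
From mathcomp Require Import measurable_realfun zify ring lra.
Import Order.TTheory GRing.Theory Num.Theory.
Import numFieldNormedType.Exports.
Set Implicit Arguments.
Unset Strict Implicit.
Unset Printing Implicit Defensive.
Local Open Scope classical_set_scope.
Local Open Scope ring_scope.


(** The estimate is the efficiency of a residual, and it is proved with bubble
    functions.  Fix a triangle K of diameter h, let p be the polynomial
    [L2proj m g] on K, and choose a test function v supported inside K such that
    the integral of p v is comparable to the squared norm of p, while v and
    h^m D^m v are bounded by p in norm.  Since v vanishes at all vertices, the
    point forces disappear from F(v); since D^m (Inc u) and the projection of G
    are constant on K and D^m v has integral zero there, the equation
    a(u, v) = F(v) becomes
<<
      int_K p v = int_K D^m (u - Inc u) : D^m v - int_K (G - Pi_0 G) : D^m v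
                  - int_K (g - p) v.
>>
    Young's inequality absorbs the contributions of v, which bounds the norm of
    h^m p, hence of h^m g, on K ([local_estimate]).  The mesh size vanishes
    outside the open triangles, which are pairwise disjoint, so the squares of
    the local estimates add up ([mesh_L2norm], [mesh_sum_le]).

    The function v.  Shape regularity provides a square inside K whose side is
    comparable to h ([square_in_shape_regular]).  In coordinates scaled to this
    square, p has coefficients a_ij on the monomials xi^i zeta^j.  If psi_i are
    smooth functions with support in [-1, 1] and dual to the monomials
    ([dual_system]: a Gram matrix is invertible), then the sum v of the functions
    a_ij psi_i(xi) psi_j(zeta) has integral rho^2 |a|^2 against p, where rho is
    the half-side.  All norms of p and of v in question are bounded by |a| times
    explicit powers of rho ([dual_bubble]), so no equivalence of norms and no
    affine transformation of K is involved.

    Weak derivatives.  They are only determined up to null sets, as elements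
    picked among all candidates, so the computation rests on their uniqueness
    ([is_wderiv_unique]), which follows from the fundamental lemma of the calculus
    of variations ([fundamental_lemma]).  Its test functions are products of
    dilates of exp(-1/x), which converge to indicator functions of boxes.  On
    smooth functions weak derivatives are classical ones, by Fubini's theorem and
    integration by parts along lines ([is_wderiv_smooth]).

    Geometry.  The open triangles lie in the domain because a Lipschitz boundary
    is not interior to the closure ([lipschitz_interior_closure]); they are
    disjoint and contain no vertex because faces are not interior to a triangle
    ([face_not_interior]). *)

(** * Square-integrable functions on open sets of the plane *)

Section MeasurePlane.
Context {R : realType}.
Local Notation mu := (@leb2 R).
Local Notation T2 := (measurableTypeR R * measurableTypeR R)%type.
Local Notation meas2 := (@measurable _ T2).
Local Notation mfun2 := (@measurable_fun _ _ T2 R).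
Implicit Types (U K : set (R * R)) (f g : R * R -> R).

Definition obox (a b c d : R) : set (R * R) := [set x | a < x.1 < b /\ c < x.2 < d].

Lemma oboxE a b c d : obox a b c d = `]a, b[%classic `*` `]c, d[%classic.
Proof. by apply/seteqP; split => x /=; rewrite !in_itv/=. Qed.

Lemma measurable_obox a b c d : meas2 (obox a b c d).
Proof. by rewrite oboxE; apply: measurableX. Qed.

Definition rbox (q : rat * rat * (rat * rat)) : set (R * R) :=
  obox (ratr q.1.1) (ratr q.1.2) (ratr q.2.1) (ratr q.2.2).

Definition cbox (a b c d : R) : set (R * R) := [set x | a <= x.1 <= b /\ c <= x.2 <= d].

Lemma cboxE a b c d : cbox a b c d = `[a, b]%classic `*` `[c, d]%classic.
Proof. by apply/seteqP; split => x /=; rewrite !in_itv/=. Qed.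

Definition crbox (q : rat * rat * (rat * rat)) : set (R * R) :=
  cbox (ratr q.1.1) (ratr q.1.2) (ratr q.2.1) (ratr q.2.2).

Lemma sub_obox_cbox a b c d : obox a b c d `<=` cbox a b c d.
Proof. by move=> x [/andP[? ?] /andP[? ?]]; split; rewrite !ltW. Qed.

(** Keeping the closed box inside U leaves room for test functions supported in
    it, while countably many open boxes already cover U. *)
Lemma open_rbox U x : open U -> U x ->
  exists q, rbox q x /\ crbox q `<=` U.
Proof.
move=> oU Ux; have := open_nbhs_nbhs (conj oU Ux).
move=> /nbhs_ballP[e /= e0 eU].
have H (t : R) : exists q : rat * rat, t - e < ratr q.1 < t /\ t < ratr q.2 < t + e.
  have /rat_in_itvoo[q1 q1P] : t - e < t by rewrite ltrBlDr ltrDl.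
  have /rat_in_itvoo[q2 q2P] : t < t + e by rewrite ltrDl.
  by exists (q1, q2).
have [p [/andP[p1 p2] /andP[p3 p4]]] := H x.1.
have [q [/andP[q1 q2] /andP[q3 q4]]] := H x.2.
exists (p, q); split; first by split; apply/andP; split.
move=> y [/andP[/= y1 y2] /andP[/= y3 y4]]; apply: eU; split;
  rewrite /ball/= ltr_norml; apply/andP; split; lra.
Qed.

Lemma open_rboxE U : open U -> U = \bigcup_(q in [set q | crbox q `<=` U]) rbox q.
Proof.
move=> oU; apply/seteqP; split => [x Ux|x [q /= qU /sub_obox_cbox]]; last exact: qU.
by have [q [qx qU]] := open_rbox oU Ux; exists q.
Qed.

Lemma open_measurable2 U : open U -> meas2 U.
Proof.
move=> oU; rewrite (open_rboxE oU) bigcup_mkcond.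
apply: countable_bigcupT_measurable => // q.
by case: ifP => // _; exact: measurable_obox.
Qed.

Lemma continuous_measurable2 U f : meas2 U -> continuous f -> mfun2 U f.
Proof.
move=> mU cf; apply: (@measurable_funS _ _ _ _ setT) => //.
apply: (measurability _ (RGenOpens.measurableE R)).
move=> _ [_ [a [b ->] <-]]; rewrite setTI; apply: open_measurable2.
by apply: open_comp => [? _|]; [exact: cf|exact: interval_open].
Qed.

Lemma ae_leb2S (P Q : R * R -> Prop) : (forall x, P x -> Q x) ->
  {ae mu, forall x, P x} -> {ae mu, forall x, Q x}.
Proof. by move=> PQ; exact: (@filterS _ _ (ae_filter_ringOfSetsType mu)). Qed.

Lemma integral_sq_mkcond U f :
  (\int[mu]_x (`|(EFin \o (f \_ U)) x| `^ 2%R) = \int[mu]_(x in U) (f x ^+ 2)%:E)%E.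
Proof.
rewrite [RHS]integral_mkcond; apply: eq_integral => x _ /=.
rewrite powR_mulrn ?normr_ge0// real_normK ?num_real//.
by rewrite !patchE; case: ifP => // _; rewrite expr0n.
Qed.

Lemma sq_integral_ge0 U f : (0 <= \int[mu]_(x in U) (f x ^+ 2)%:E)%E.
Proof. by apply: integral_ge0 => x _; rewrite lee_fin sqr_ge0. Qed.

(** Trades the norm of the zero extension for the integral over U of the square,
    the form in which all estimates are carried out. *)
Lemma L2P U f : meas2 U -> L2 U f <->
  mfun2 U f /\ mu.-integrable U (EFin \o (fun x => f x ^+ 2)).
Proof.
move=> mU; rewrite /L2 /finite_norm unlock integral_sq_mkcond; split => -[mf h];
  split => //.
- apply/integrableP; split.
    by apply/measurable_EFinP; exact: measurable_funX.
  under eq_integral do rewrite /= ger0_norm ?sqr_ge0//.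
  move: h; case: integral => [r| |] //=; first by rewrite !ltry.
  by have -> : (2^-1 == 0 :> R) = false by apply/negbTE; rewrite invr_eq0.
- have /integrableP[_] := h.
  under eq_integral do rewrite /= ger0_norm ?sqr_ge0//.
  exact: poweR_lty.
Qed.

Lemma L2_measurable U f : L2 U f -> mfun2 U f.
Proof. by case. Qed.

Lemma L2_sqr_integrable U f : meas2 U -> L2 U f ->
  mu.-integrable U (EFin \o (fun x => f x ^+ 2)).
Proof. by move=> mU /(L2P _ mU)[]. Qed.

Lemma L2normE U f : meas2 U -> L2 U f ->
  L2norm U f ^+ 2 = \int[mu]_(x in U) (f x ^+ 2).
Proof.
move=> mU fU; rewrite /L2norm unlock integral_sq_mkcond.
have fin := integrable_fin_num mU (L2_sqr_integrable mU fU).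
have I0 := sq_integral_ge0 U f.
rewrite -(fineK fin) poweR_EFin /= powR12_sqrt ?fine_ge0//.
by rewrite sqr_sqrtr ?fine_ge0.
Qed.

Lemma L2norm_ge0 U f : 0 <= L2norm U f.
Proof. by rewrite /L2norm fine_ge0// Lnorm_ge0. Qed.

Lemma L2_mul_integrable U f g : meas2 U -> L2 U f -> L2 U g ->
  mu.-integrable U (EFin \o (fun x => f x * g x)).
Proof.
move=> mU Lf Lg.
have := integrableD mU (L2_sqr_integrable mU Lf) (L2_sqr_integrable mU Lg).
apply: le_integrable => //.
  by apply/measurable_EFinP/measurable_funM; exact: L2_measurable.
move=> x _ /=; rewrite lee_fin [leRHS]ger0_norm ?addr_ge0 ?sqr_ge0//.
rewrite normrM -(real_normK (num_real (f x))) -(real_normK (num_real (g x))).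
by have := sqr_ge0 (`|f x| - `|g x|); have := normr_ge0 (f x); have := normr_ge0 (g x); nra.
Qed.

Lemma L2Z U k f : meas2 U -> L2 U f -> L2 U (fun x => k * f x).
Proof.
move=> mU Lf; apply/L2P => //; split.
  by apply: measurable_funM => //; exact: L2_measurable.
have := integrableZl mU (k ^+ 2) (L2_sqr_integrable mU Lf).
by apply: eq_integrable => // x _ /=; rewrite -EFinM exprMn.
Qed.

Lemma L2D U f g : meas2 U -> L2 U f -> L2 U g -> L2 U (fun x => f x + g x).
Proof.
move=> mU Lf Lg; apply/L2P => //; split.
  by apply: measurable_funD => //; exact: L2_measurable.
have := integrableD mU (integrableD mU (L2_sqr_integrable mU Lf) (L2_sqr_integrable mU Lg))
  (integrableZl mU 2 (L2_mul_integrable mU Lf Lg)).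
apply: eq_integrable => // x _ /=; rewrite -EFinM -!EFinD; congr EFin.
by ring.
Qed.

Lemma L2B U f g : meas2 U -> L2 U f -> L2 U g -> L2 U (fun x => f x - g x).
Proof.
move=> mU Lf Lg; have := L2D mU Lf (L2Z (-1) mU Lg).
by congr (L2 U); apply/funext => x; rewrite mulN1r.
Qed.

Lemma L2S U V f : meas2 U -> meas2 V -> V `<=` U -> L2 U f -> L2 V f.
Proof.
move=> mU mV VU /(L2P _ mU)[mf fi]; apply/L2P => //; split.
  exact: measurable_funS mf.
exact: integrableS fi.
Qed.

Lemma L2_ae U f g : meas2 U -> L2 U f -> mfun2 U g ->
  {ae mu, forall x, U x -> f x = g x} -> L2 U g.
Proof.
move=> mU /(L2P _ mU)[mf fi] mg fg; apply/L2P => //; split => //.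
have mg2 : @measurable_fun _ _ T2 _ U (EFin \o (fun x => g x ^+ 2)).
  by apply/measurable_EFinP; exact: measurable_funX.
have /integrableP[mf2 hf] := fi.
apply/integrableP; split => //.
suff -> : (\int[mu]_(x in U) `|(EFin \o (fun x => (g x ^+ 2)%R)) x| =
  \int[mu]_(x in U) `|(EFin \o (fun x => (f x ^+ 2)%R)) x|)%E by [].
apply: ae_eq_integral => //.
- exact: measurableT_comp.
- exact: measurableT_comp.
- by apply: ae_leb2S fg => x h Ux /=; rewrite h.
Qed.

Lemma ae_eq_Rintegral U f g : meas2 U -> mfun2 U f -> mfun2 U g ->
  {ae mu, forall x, U x -> f x = g x} ->
  \int[mu]_(x in U) f x = \int[mu]_(x in U) g x.
Proof.
move=> mU mf mg fg; rewrite /Rintegral; congr fine; apply: ae_eq_integral => //.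
- exact/measurable_EFinP.
- exact/measurable_EFinP.
- by apply: ae_leb2S fg => x h Ux /=; rewrite h.
Qed.

Lemma Rintegral_support U V f : V `<=` U -> (forall x, U x -> ~ V x -> f x = 0) ->
  \int[mu]_(x in U) f x = \int[mu]_(x in V) f x.
Proof.
move=> VU f0; rewrite Rintegral_mkcond [RHS]Rintegral_mkcond.
congr (Rintegral mu _ _); apply/funext => x; rewrite !patchE.
case: ifPn => [/set_mem Ux|/negP nU]; case: ifPn => [/set_mem Vx|/negP nV] //.
- by apply: f0 => // Vx; apply: nV; rewrite inE.
- by exfalso; apply: nU; rewrite inE; exact: VU.
Qed.

End MeasurePlane.

(** * Smooth functions of one variable and the function exp(-1/x) *)

Section Smooth1.
Context {R : realType}.
Implicit Types (f g : R -> R) (p q : {poly R}).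

(** Recursion on the derivative itself, rather than a condition on the iterated
    derivatives, makes stability under products a plain induction. *)
Fixpoint Cn n f : Prop :=
  if n is k.+1 then (forall x, derivable f x 1) /\ Cn k (derive1 f) else True.

Definition smooth1 f := forall n, Cn n f.

Lemma is_derive_derive1 f f' : (forall x, is_derive x (1 : R) f (f' x)) ->
  (forall x, derivable f x 1) /\ (derive1 f) = f'.
Proof.
move=> H; split; first by move=> x; apply: ex_derive.
by apply/funext => x; rewrite derive1E derive_val.
Qed.

Lemma is_derive_subst (x : R) f a : is_derive x (1 : R) f a ->
  forall g b, f = g -> a = b -> is_derive x (1 : R) g b.
Proof. by move=> h g b <- <-. Qed.

Lemma derivable_is_derive1 f : (forall x, derivable f x 1) ->
  forall x, is_derive x (1 : R) f ((derive1 f) x).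
Proof. by move=> df x; rewrite derive1E; apply: derivableP. Qed.

Lemma CnW n f : Cn n.+1 f -> Cn n f.
Proof. by elim: n f => // n IH f [df /IH]. Qed.

Lemma smooth1_derivable f : smooth1 f -> forall x, derivable f x 1.
Proof. by move=> /(_ 1%N)[]. Qed.

Lemma smooth1_der f : smooth1 f -> smooth1 (derive1 f).
Proof. by move=> sf n; case: (sf n.+1). Qed.

Lemma smooth1_is_der f : smooth1 f -> forall x, is_derive x (1 : R) f ((derive1 f) x).
Proof. by move=> /smooth1_derivable/derivable_is_derive1. Qed.

Lemma smooth1_cont f : smooth1 f -> continuous f.
Proof.
by move=> sf x; apply/differentiable_continuous/derivable1_diffP/smooth1_derivable.
Qed.

Lemma smooth1_dern f k : smooth1 f -> smooth1 (derive1n (k) f).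
Proof. by move=> sf; elim: k => // k IH; exact: smooth1_der. Qed.

(** A coinduction principle: a class of functions that is stable under
    differentiation consists of smooth functions. *)
Lemma smooth1_class (P : (R -> R) -> Prop) :
  (forall f, P f -> exists2 f', P f' & forall x, is_derive x (1 : R) f (f' x)) ->
  forall f, P f -> smooth1 f.
Proof.
move=> H f Pf n; elim: n f Pf => // n IH f /H[f' Pf' /is_derive_derive1[df E]] /=;
  rewrite E.
by split=> //; exact: IH.
Qed.

Lemma CnD n f g : Cn n f -> Cn n g -> Cn n (fun x => f x + g x).
Proof.
elim: n f g => // n IH f g [df cf] [dg cg].
rewrite [Cn _ _]/=; have [|d ->] := @is_derive_derive1 (fun x => f x + g x) (fun x =>
  (derive1 f) x + (derive1 g) x).
  by move=> x; apply: is_deriveD; exact: derivable_is_derive1.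
by split=> //; exact: IH.
Qed.

Lemma CnM n f g : Cn n f -> Cn n g -> Cn n (fun x => f x * g x).
Proof.
elim: n f g => // n IH f g [df cf] [dg cg].
rewrite [Cn _ _]/=; have [|d ->] := @is_derive_derive1 (fun x => f x * g x) (fun x =>
  f x * (derive1 g) x + g x * (derive1 f) x).
  move=> x; have := is_deriveM (derivable_is_derive1 df x) (derivable_is_derive1 dg x).
  by move/is_derive_subst; apply.
split=> //; apply: CnD; apply: IH => //; exact: CnW.
Qed.

Lemma smooth1D f g : smooth1 f -> smooth1 g -> smooth1 (fun x => f x + g x).
Proof. by move=> sf sg n; exact: CnD. Qed.

Lemma smooth1M f g : smooth1 f -> smooth1 g -> smooth1 (fun x => f x * g x).
Proof. by move=> sf sg n; exact: CnM. Qed.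

Lemma smooth1_poly p : smooth1 (horner p).
Proof.
apply: (smooth1_class (P := fun f => exists p, f = horner p)); last by exists p.
by move=> _ [q ->]; exists (horner q^`()); [exists q^`()|move=> x; exact: is_derive_poly].
Qed.

Lemma smooth1_cst c : smooth1 (fun=> c).
Proof.
by have := smooth1_poly c%:P; congr smooth1; apply/funext => x; rewrite hornerC.
Qed.

Lemma is_derive_affine f (c k y x : R) : is_derive ((x - c) * k) 1 f y ->
  is_derive x (1 : R) (fun x => f ((x - c) * k)) (k * y).
Proof.
move=> df; have dg : is_derive x (1:R) (fun x => (x - c) * k) k.
  have -> : (fun x => (x - c) * k) = (horner ((('X - c%:P) * k%:P))).
    by apply/funext => z; rewrite !hornerE.
  have := is_derive_poly (('X - c%:P) * k%:P) x; move/is_derive_subst; apply => //;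
    rewrite derivM derivB derivX !derivC !hornerE; ring.
by rewrite mulrC; exact: is_derive1_comp.
Qed.

Lemma smooth1_affine f c k : smooth1 f -> smooth1 (fun x => f ((x - c) * k)).
Proof.
move=> sf n; have : Cn n f by [].
elim: n {sf} f => // n IH f [df cf].
rewrite [Cn _ _]/=; have [|d ->] := @is_derive_derive1 (fun x =>
  f ((x - c) * k)) (fun x => k * (derive1 f) ((x - c) * k)).
  by move=> x; apply: is_derive_affine; exact: derivable_is_derive1.
by split=> //; apply: CnM; [exact: smooth1_cst|exact: IH].
Qed.

Lemma derive1n_affine f c k n : smooth1 f ->
  derive1n n (fun x => f ((x - c) * k)) = (fun x =>
    k ^+ n * (derive1n (n) f) ((x - c) * k)).
Proof.
move=> sf; elim: n => [|n IH]; first by apply/funext => x; rewrite expr0 mul1r.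
rewrite derive1nS IH.
have [|_ ->] := @is_derive_derive1 (fun x =>
  k ^+ n * derive1n n f ((x - c) * k)) (fun x =>
  k ^+ n.+1 * (derive1n (n.+1) f) ((x - c) * k)); last by [].
move=> x; rewrite exprSr -mulrA.
apply: (is_deriveZ (k ^+ n)); apply: is_derive_affine.
rewrite derive1nS; exact/smooth1_is_der/smooth1_dern.
Qed.

(** p(1/x) exp(-1/x) extended by zero: a family that contains the extension of
    exp(-1/x) and is stable under differentiation. *)
Definition flat p (x : R) : R := if 0 < x then p.[x^-1] * expR (- x^-1) else 0.

Lemma monom_expRN_le n (t : R) : 0 <= t -> t ^+ n * expR (- t) <= n`!%:R.
Proof.
move=> t0; rewrite expRN ler_pdivrMr ?expR_gt0//.
case: n => [|n]; first
  by rewrite expr0 mul1r -[leLHS]addr0 (le_trans _ (expR_ge1Dx t))// lerD2l.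
have := expR_ge1Dxn n t0; rewrite mulrC -ler_pdivrMl ?ltr0n ?fact_gt0//.
by apply: le_trans; rewrite mulrC lerDr.
Qed.

Lemma poly_expRN_bounded p : exists2 C : R, 0 <= C & forall t : R, 0 <= t ->
  `|p.[t]| * expR (- t) <= C.
Proof.
exists (\sum_(i < size p) `|p`_i| * (i`!)%:R); first by apply: sumr_ge0 => i _;
  rewrite mulr_ge0.
move=> t t0; rewrite horner_coef.
apply: (@le_trans _ _ (\sum_(i < size p) `|p`_i| * t ^+ i * expR (- t))).
  rewrite -mulr_suml ler_wpM2r ?expR_ge0//; apply: (le_trans (ler_norm_sum _ _ _)).
  by apply: ler_sum => i _; rewrite normrM normrX (ger0_norm t0).
by apply: ler_sum => i _; rewrite -mulrA ler_wpM2l// monom_expRN_le.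
Qed.

Lemma flat_bound p : exists2 C : R, 0 <= C & forall x, `|flat p x| <= C.
Proof.
have [C C0 HC] := poly_expRN_bounded p; exists C => // x; rewrite /flat; case: ifP => x0.
  by rewrite normrM (ger0_norm (expR_ge0 _)); apply: HC; rewrite invr_ge0 ltW.
by rewrite normr0.
Qed.

(** For x > 0 the derivative of p(1/x) exp(-1/x) is x^-2 (p - p')(1/x) exp(-1/x). *)
Definition dflat p : {poly R} := 'X^2 * (p - p^`()).

(** At 0 the difference quotient is at most C |h| in absolute value, because
    [flat ('X^2 * p)] is bounded. *)
Lemma flat_der p x : is_derive x (1 : R) (flat p) (flat (dflat p) x).
Proof.
have [x0|x0|x0] := ltgtP 0 x.
  have H1 := @near_eq_is_derive R R R (fun x : R =>
    p.[x^-1] * expR (- x^-1)) (flat p) x (1:R). apply: H1.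
    near=> y; rewrite /flat ifT//; near: y; exact: lt_nbhsr.
  have xn0 : x != 0 by rewrite gt_eqF.
  have dV : is_derive x (1 : R) (fun x : R => x^-1) (- x ^- 2).
    have := @is_deriveV _ id x 1 1 xn0 (is_derive_id _ _).
    by move/is_derive_subst; apply => //; rewrite /GRing.scale /= mulr1.
  have d1 : is_derive x (1 : R) (fun x => p.[x^-1]) (p^`().[x^-1] * - x ^- 2).
    exact: (is_derive1_comp (f := horner p)).
  have d2 : is_derive x (1 : R) (fun x => expR (- x^-1)) (expR (- x^-1) * - - x ^- 2).
    apply: (is_derive1_comp (f := expR) (g := fun x => - x^-1)).
  have := is_deriveM d1 d2; move/is_derive_subst; apply => //.
  rewrite /flat x0 /dflat !hornerE /GRing.scale /=.
  by rewrite -exprVn; ring.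
- have H1 := @near_eq_is_derive R R R (fun=> 0) (flat p) x (1:R); apply: H1.
    near=> y; rewrite /flat ifF//; apply/negbTE; rewrite -leNgt ltW//.
    near: y; exact: lt_nbhsl.
  by rewrite /flat ltNge (ltW x0)/=; exact: is_derive_cst.
- rewrite -x0 [X in is_derive _ _ _ X]/flat ltxx.
  have [C C0 HC] := flat_bound ('X^2 * p).
  have H y : `|flat p y| <= C * y ^+ 2.
    have := HC y; rewrite /flat; case: ifP => y0; last by rewrite normr0 mulr_ge0 ?sqr_ge0.
    rewrite hornerM hornerXn exprVn -mulrA normrM normfV normrX ler_pdivrMl ?exprn_gt0 ?normr_gt0 ?gt_eqF//.
    by rewrite (gtr0_norm y0) [_ * C]mulrC.
  have lim0 : h^-1 *: ((flat p \o shift 0) (h *: (1:R)) - flat p 0) @[h -->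
    (0:R)^'] --> (0 : R).
    apply/cvgrPdist_le => e e0.
    near=> h; rewrite /= scaler1 addr0 [flat p 0]/flat ltxx subr0 sub0r normrN /GRing.scale /=.
    rewrite normrM normfV ler_pdivrMl; last by rewrite normr_gt0; near: h;
      exact: nbhs_dnbhs_neq.
    apply: (le_trans (H h)); rewrite -real_normK ?num_real// expr2 mulrA mulrC ler_wpM2l//.
    have : `|h| <= e / (C + 1).
      by near: h; apply: dnbhs0_le; rewrite divr_gt0// ltr_wpDl.
    by rewrite ler_pdivlMr ?ltr_wpDl//; have := normr_ge0 h; nra.
  apply: DeriveDef; first by apply/cvg_ex; exists 0.
  by apply/cvg_lim.
Unshelve. all: by end_near.
Qed.

Lemma smooth1_flat p : smooth1 (flat p).
Proof.
apply: (smooth1_class (P := fun f => exists p, f = flat p)); last by exists p.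
by move=> _ [q ->]; exists (flat (dflat q)); [exists (dflat q)|exact: flat_der].
Qed.

Definition theta : R -> R := flat 1.

Lemma thetaE x : theta x = if 0 < x then expR (- x^-1) else 0.
Proof. by rewrite /theta /flat hornerC mul1r. Qed.

Lemma theta_ge0 x : 0 <= theta x.
Proof. by rewrite thetaE; case: ifP => // _; exact: expR_ge0. Qed.

Lemma theta_le1 x : theta x <= 1.
Proof.
rewrite thetaE; case: ifP => // x0; rewrite -expR0 ler_expR oppr_le0 invr_ge0; exact: ltW.
Qed.

Lemma theta_gt0 x : 0 < x -> 0 < theta x.
Proof. by move=> x0; rewrite thetaE x0 expR_gt0. Qed.

Lemma theta_le0 x : x <= 0 -> theta x = 0.
Proof. by move=> x0; rewrite thetaE ltNge x0. Qed.

End Smooth1.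

(** * Finite sums of products of one-variable functions *)

Section TensorSums.
Context {R : realType}.
Local Notation mu := (@leb2 R).
Local Notation T2 := (measurableTypeR R * measurableTypeR R)%type.
Local Notation meas2 := (@measurable _ T2).
Local Notation mfun2 := (@measurable_fun _ _ T2 R).
Implicit Types (U K : set (R * R)) (f g F phi psi : R * R -> R).

Definition coord (b : bool) (x : R * R) : R := if b then x.2 else x.1.
(** The restriction of F to a line in the direction [pdir b], which turns partial
    derivatives into derivatives of functions of one variable. *)
Definition slice (b : bool) F (x : R * R) (t : R) : R :=
  if b then F (x.1, t) else F (t, x.2).

Lemma slice_coord b F x : slice b F x (coord b x) = F x.
Proof. by case: b; case: x. Qed.

Lemma pair_ext (A B : Type) (x y : A * B) : x.1 = y.1 -> x.2 = y.2 -> x = y.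
Proof. by case: x; case: y => /= ? ? ? ? -> ->. Qed.

Lemma growth_slice b F x :
  (fun h : R => h^-1 *: ((F \o shift x) (h *: pdir b) - F x)) =
  (fun h : R => h^-1 *: ((slice b F x \o shift (coord b x)) (h *: (1 :
    R)) - slice b F x (coord b x))).
Proof.
apply/funext => h; rewrite slice_coord; case: x => x1 x2; case: b => /=;
  congr (_ *: (F _ - _)); apply: pair_ext => //=; rewrite /GRing.scale/=.
  - exact: (etrans (congr1 (+%R^~ x1) (mulr0 h)) (add0r x1)).
  - exact: (etrans (congr1 (+%R^~ x2) (mulr0 h)) (add0r x2)).
Qed.

Lemma derivable_slice b F x :
  derivable F x (pdir b) <-> derivable (slice b F x) (coord b x) 1.
Proof. by rewrite /derivable growth_slice. Qed.

Lemma derive_slice b F x : 'D_(pdir b) F x = derive1 (slice b F x) (coord b x).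
Proof. by rewrite derive1E /derive growth_slice. Qed.

Lemma is_derive_slice b F x d :
  is_derive x (pdir b) F d <-> is_derive (coord b x) (1:R) (slice b F x) d.
Proof.
split=> -[h1 h2]; apply: DeriveDef; try by apply/(derivable_slice b).
  by rewrite -h2 derive_slice derive1E.
by rewrite derive_slice derive1E.
Qed.

(** Polynomials and sums of products of bumps have this form; it is stable under
    partial derivatives, and iterated ones have a closed form
    ([pderivs_tsum]) that does not depend on the order of differentiation. *)
Definition tsum (I : finType) (f g : I -> R -> R) (x : R * R) : R :=
  \sum_i f i x.1 * g i x.2.

Lemma is_derive_bigop (J : Type) (r : seq J) (V : normedModType R) (h dh : J -> V ->
  R) (x v : V) :
  (forall i, is_derive x v (h i) (dh i x)) ->
  is_derive x v (fun y => \sum_(i <- r) h i y) (\sum_(i <- r) dh i x).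
Proof.
move=> H; elim: r => [|i r IH].
  rewrite big_nil (_ : (fun y => _) = cst 0); last by apply/funext => y; rewrite big_nil.
  exact: is_derive_cst.
rewrite big_cons (_ : (fun y => _) = h i \+ (fun y => \sum_(i <- r) h i y)).
  exact: is_deriveD.
by apply/funext => y; rewrite big_cons.
Qed.

Lemma is_derive_tsum (I : finType) (f g : I -> R -> R) b x :
  (forall i, smooth1 (f i)) -> (forall i, smooth1 (g i)) ->
  is_derive x (pdir b) (tsum f g)
    (tsum (fun i => if b then f i else derive1 (f i)) (fun i =>
      if b then derive1 (g i) else g i) x).
Proof.
move=> sf sg; apply/is_derive_slice; rewrite /tsum /slice.
case: b => /=.
- apply: (@is_derive_bigop _ _ R^o (fun i t => f i x.1 * g i t) (fun i t =>
    f i x.1 * derive1 (g i) t)) => i.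
  by apply: (is_deriveZ (f i x.1)); exact: smooth1_is_der.
- apply: (@is_derive_bigop _ _ R^o (fun i t => f i t * g i x.2) (fun i t =>
    derive1 (f i) t * g i x.2)) => i.
  rewrite mulrC (_ : (fun t => _) = (fun t => g i x.2 * f i t));
    last by apply/funext => t; rewrite mulrC.
  by apply: (is_deriveZ (g i x.2)); exact: smooth1_is_der.
Qed.

Lemma pderivs_tsum (I : finType) (f g : I -> R -> R) s :
  (forall i, smooth1 (f i)) -> (forall i, smooth1 (g i)) ->
  pderivs s (tsum f g) =
  tsum (fun i => derive1n (count negb s) (f i)) (fun i => derive1n (count id s) (g i)).
Proof.
move=> sf sg; elim: s => [//|b s IH] /=.
rewrite IH; apply/funext => x.
have [||_ ->] := @is_derive_tsum I (fun i => derive1n (count negb s) (f i)) (fun i =>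
  derive1n (count id s) (g i)) b x.
  by move=> i; exact: smooth1_dern.
  by move=> i; exact: smooth1_dern.
case: b; apply: eq_bigr => i _; rewrite ?add0n ?add1n; by rewrite derive1nS.
Qed.

Lemma continuous_tsum (I : finType) (f g : I -> R -> R) :
  (forall i, smooth1 (f i)) -> (forall i, smooth1 (g i)) -> continuous (tsum f g).
Proof.
move=> sf sg; rewrite /tsum.
elim: (index_enum I) => [|i r IH] x.
  by rewrite (_ : (fun x => _) = cst 0); [exact: cvg_cst|apply/funext => y;
    rewrite big_nil].
rewrite (_ : (fun x => _) = (fun x => f i x.1 * g i x.2) \+ (fun x =>
  \sum_(i <- r) f i x.1 * g i x.2)); last by apply/funext => y; rewrite big_cons.
apply: cvgD; last exact: IH.
apply: cvgM; apply: continuous_comp.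
- exact: cvg_fst.
- exact: smooth1_cont.
- exact: cvg_snd.
- exact: smooth1_cont.
Qed.

Lemma smooth_tsum (I : finType) (f g : I -> R -> R) :
  (forall i, smooth1 (f i)) -> (forall i, smooth1 (g i)) -> smooth (tsum f g).
Proof.
move=> sf sg s; rewrite pderivs_tsum//; split.
  by apply: continuous_tsum => i; exact: smooth1_dern.
move=> b x; apply: ex_derive; apply: is_derive_tsum => i; exact: smooth1_dern.
Qed.

Lemma pderivs_cat s1 s2 phi : pderivs s1 (pderivs s2 phi) = pderivs (s1 ++ s2) phi.
Proof. by rewrite /pderivs foldr_cat. Qed.

Lemma smooth_pderivs s phi : smooth phi -> smooth (pderivs s phi).
Proof. by move=> sp t; rewrite pderivs_cat; exact: sp. Qed.

Lemma smooth_cont phi : smooth phi -> continuous phi.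
Proof. by move=> /(_ [::])[]. Qed.

(** The complement of K is open, so phi vanishes near each of its points. *)
Lemma pderivs_supp K s phi : closed K -> (forall x, ~ K x -> phi x = 0) ->
  forall x, ~ K x -> pderivs s phi x = 0.
Proof.
move=> cK p0; elim: s => [//|b s IH] x Kx /=.
have oC : open (~` K) by rewrite openC.
rewrite (@near_eq_derive R _ _ _ (cst 0)); first exact: derive_cst.
have : nbhs x (~` K) by apply: open_nbhs_nbhs.
by apply: filterS => y; exact: IH.
Qed.

Lemma test_fun_pderivs U s phi : test_fun U phi -> test_fun U (pderivs s phi).
Proof.
move=> [sp [K [cK KU K0]]]; split; first exact: smooth_pderivs.
exists K; split=> //; apply: pderivs_supp => //.
by apply: compact_closed => //; exact: norm_hausdorff.
Qed.

Lemma test_fun_sub U V phi : U `<=` V -> test_fun U phi -> test_fun V phi.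
Proof. by move=> UV [sp [K [cK KU K0]]]; split=> //; exists K; split=> // x /KU/UV. Qed.

Lemma leb2_obox (a b c d : R) : a < b -> c < d ->
  mu (obox a b c d) = ((b - a) * (d - c))%:E.
Proof.
move=> ab cd; rewrite oboxE; apply: (etrans (product_measure1E _ _ _ _)) => //.
have E (s t : R) : s < t -> (lebesgue_measure (`]s, t[%classic : set R) = (t - s)%:E)%E.
  by move=> st; rewrite lebesgue_measure_itv/= lte_fin st EFinB.
by rewrite EFinM; congr (_ * _)%E; exact: E.
Qed.

Lemma compact_box K : compact K -> exists2 M, 0 < M & K `<=` obox (- M) M (- M) M.
Proof.
move=> /compact_bounded[M [_ HM]].
exists (`|M| + 1); first by rewrite ltr_wpDl.
move=> x Kx; have : `|x| <= `|M| + 1 / 2.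
  by apply: HM => //; have := ler_norm M; lra.
rewrite prod_normE ge_max !ler_norml => /andP[/andP[h1 h2] /andP[h3 h4]].
by split; apply/andP; split; lra.
Qed.

Lemma bounded_box_integrable U f (M a b c d : R) : meas2 U -> mfun2 U f ->
  a < b -> c < d ->
  (forall x, U x -> `|f x| <= M) -> (forall x, U x -> ~ obox a b c d x -> f x = 0) ->
  mu.-integrable U (EFin \o f).
Proof.
move=> mU mf ab cd fM f0.
have mB : meas2 (obox a b c d) := measurable_obox a b c d.
have mUB : meas2 (U `&` obox a b c d) by exact: measurableI.
have fin : (mu (U `&` obox a b c d) < +oo)%E.
  apply: (@le_lt_trans _ _ (mu (obox a b c d))); last by rewrite leb2_obox// ltry.
  by apply: le_measure; rewrite ?inE//; exact: subIsetr.
have mf' : @measurable_fun _ _ T2 _ U (EFin \o f) by exact/measurable_EFinP.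
apply/integrableP; split => //.
apply: (@le_lt_trans _ _ (\int[mu]_(x in U) (`|M| * \1_(U `&` obox a b c d) x)%:E)%E).
  apply: ge0_le_integral => //.
  - exact: measurableT_comp.
  - apply/measurable_EFinP; apply: measurable_funM => //; exact: measurable_indic.
  - move=> x Ux; rewrite /= lee_fin indicE; case: (boolP (x \in _)) => /= h.
      by rewrite mulr1 (le_trans (fM x Ux))// ler_norm.
    rewrite mulr0 f0 ?normr0// => Bx; move/negP: h; apply; rewrite inE; split => //.
under eq_integral do rewrite EFinM.
have mi : @measurable_fun _ _ T2 _ U (EFin \o (\1_(U `&` obox a b c d) : R * R -> R)).
  by apply/measurable_EFinP; exact: measurable_indic.
rewrite ge0_integralZl_EFin//.
rewrite integral_indic// setIAC setIid.
by rewrite lte_mul_pinfty.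
Qed.

End TensorSums.

(** * Compactly supported functions *)

Section CompactSupport.
Context {R : realType}.
Local Notation mu := (@leb2 R).
Local Notation T2 := (measurableTypeR R * measurableTypeR R)%type.
Local Notation meas2 := (@measurable _ T2).
Local Notation mfun2 := (@measurable_fun _ _ T2 R).
Implicit Types (U K : set (R * R)) (f g F phi psi : R * R -> R).

Lemma bounded_box_L2 U f (M a b c d : R) : meas2 U -> mfun2 U f ->
  a < b -> c < d ->
  (forall x, U x -> `|f x| <= M) -> (forall x, U x -> ~ obox a b c d x -> f x = 0) ->
  L2 U f.
Proof.
move=> mU mf ab cd fM f0; apply/L2P => //; split=> //.
apply: (bounded_box_integrable (M := M ^+ 2) (a := a) (b := b) (c := c) (d := d)) => //.
- exact: measurable_funX.
- move=> x Ux; rewrite normrX ler_sqr ?nnegrE ?fM//.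
  exact: le_trans (fM x Ux).
- by move=> x Ux Bx; rewrite f0// expr0n.
Qed.

Definition compactly_supp f :=
  continuous f /\ exists2 K, compact K & forall x, ~ K x -> f x = 0.

Lemma compactly_supp_bounded f : compactly_supp f ->
  exists M c, [/\ 0 < c, forall x, `|f x| <= M
  & forall x, ~ obox (- c) c (- c) c x -> f x = 0].
Proof.
move=> [cf [K cK K0]].
have [c c0 Kc] := compact_box cK.
have cfK : compact (f @` K).
  by apply: continuous_compact => //; apply: continuous_subspaceT.
have [M [_ HM]] := compact_bounded cfK.
exists (`|M| + 1), c; split=> // x.
- have [Kx|Kx] := pselect (K x); last by rewrite K0// normr0 addr_ge0.
  by apply: (HM (`|M| + 1)); [have := ler_norm M; lra|exists x].
- by move=> Bx; apply: K0 => /Kc.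
Qed.

Lemma compactly_supp_integrable U f : meas2 U -> compactly_supp f ->
  mu.-integrable U (EFin \o f).
Proof.
move=> mU cf; have [M [c [c0 fM f0]]] := compactly_supp_bounded cf.
apply: (bounded_box_integrable (M := M) (a := - c) (b := c) (c := - c) (d := c)) => //.
- by apply: continuous_measurable2 => //; case: cf.
- by rewrite gtrN.
- by rewrite gtrN.
- by move=> x _; exact: f0.
Qed.

Lemma compactly_supp_L2 U f : meas2 U -> compactly_supp f -> L2 U f.
Proof.
move=> mU cf; have [M [c [c0 fM f0]]] := compactly_supp_bounded cf.
apply: (bounded_box_L2 (M := M) (a := - c) (b := c) (c := - c) (d := c)) => //.
- by apply: continuous_measurable2 => //; case: cf.
- by rewrite gtrN.
- by rewrite gtrN.
- by move=> x _; exact: f0.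
Qed.

Lemma test_fun_compactly_supp U phi : test_fun U phi -> compactly_supp phi.
Proof.
by move=> [sp [K [cK KU K0]]]; split; [exact: smooth_cont|exists K].
Qed.

Lemma compactly_suppM f g : continuous f -> compactly_supp g ->
  compactly_supp (fun x => f x * g x).
Proof.
move=> cf [cg [K cK K0]]; split; last by exists K => // x Kx; rewrite K0// mulr0.
by move=> x; apply: cvgM; [exact: cf|exact: cg].
Qed.

Lemma integral_derive1_0 (F : R -> R) (M : R) : 0 < M ->
  (forall t, derivable F t 1) -> continuous (derive1 F) ->
  (forall t, ~ (- M < t < M) -> F t = 0 /\ derive1 F t = 0) ->
  (\int[lebesgue_measure]_t (derive1 F t)%:E = 0)%E.
Proof.
move=> M0 dF cF F0.
have -> : (\int[lebesgue_measure]_t (derive1 F t)%:E =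
  \int[lebesgue_measure]_(t in [set` `[- M, M]%R]) (derive1 F t)%:E)%E.
  rewrite [RHS]integral_mkcond; apply: eq_integral => t _; rewrite patchE.
  case: ifPn => // /negP tM; rewrite (F0 t _).2// => /andP[t1 t2]; apply: tM.
  by rewrite inE /= in_itv/= !ltW.
have cF' : continuous F.
  by move=> x; apply/differentiable_continuous/derivable1_diffP.
have MM : - M < M by rewrite gtrN.
have cdF : {within `[- M, M], continuous (derive1 F)} by exact: continuous_subspaceT.
have oo : derivable_oo_LRcontinuous F (- M) M.
  split; first by move=> t _; exact: dF.
    by apply: cvg_at_right_filter; exact: cF'.
  by apply: cvg_at_left_filter; exact: cF'.
rewrite (continuous_FTC2 MM cdF oo (fun _ _ => erefl)).
by rewrite (F0 M _).1 ?(F0 (- M) _).1 ?subee//; move=> /andP[]; rewrite ltxx.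
Qed.

(** By Fubini's theorem: the integral over each line in the direction [pdir b]
    is the difference of two values of psi outside its support. *)
Lemma Rintegral_derive0 b psi : compactly_supp psi ->
  (forall x, derivable psi x (pdir b)) ->
  continuous ('D_(pdir b) psi) -> \int[mu]_x 'D_(pdir b) psi x = 0.
Proof.
move=> ccp dp cD; have [_ [K cK K0]] := ccp.
have [c c0 Kc] := compact_box cK.
have D0 x : ~ K x -> 'D_(pdir b) psi x = 0.
  apply: (@pderivs_supp R K [:: b]) => //.
  by apply: compact_closed => //; exact: norm_hausdorff.
have ccD : compactly_supp ('D_(pdir b) psi) by split=> //; exists K.
have iD := compactly_supp_integrable (@measurableT _ T2) ccD.
have slice_cont x : continuous (derive1 (slice b psi x)).
  have -> : derive1 (slice b psi x) = slice b ('D_(pdir b) psi) x.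
    apply/funext => t.
    rewrite {2}/slice; case: {dp cD D0 ccD iD} b => /=.
    - by rewrite (derive_slice true).
    - by rewrite (derive_slice false).
  move=> t; rewrite /slice; case: {dp D0 ccD iD} b cD => cD.
  - apply: (@continuous_comp _ _ _ (fun t => (x.1, t)) ('D_(pdir true) psi));
      last exact: cD.
    exact: (cvg_pair (cvg_cst x.1) (@cvg_id _ (nbhs t))).
  - apply: (@continuous_comp _ _ _ (fun t => (t, x.2)) ('D_(pdir false) psi));
      last exact: cD.
    exact: (cvg_pair (@cvg_id _ (nbhs t)) (cvg_cst x.2)).
have slice_int x : (\int[lebesgue_measure]_t (slice b ('D_(pdir b) psi) x t)%:E = 0)%E.
  have E : derive1 (slice b psi x) = slice b ('D_(pdir b) psi) x.
    apply/funext => t.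
    rewrite {2}/slice; case: {dp cD D0 ccD iD slice_cont} b => /=.
    - by rewrite (derive_slice true).
    - by rewrite (derive_slice false).
  rewrite -E; apply: (integral_derive1_0 (M := c)) => //.
  - move=> t.
    case: {cD D0 ccD iD slice_cont E} b dp => dp.
    + by have [+ _] := derivable_slice true psi (x.1, t); rewrite /slice /=; apply.
    + by have [+ _] := derivable_slice false psi (t, x.2); rewrite /slice /=; apply.
  - move=> t tc; rewrite E /slice; case: {cD ccD iD slice_cont E dp} b D0 => D0.
      by split; [apply: K0|apply: D0] => /Kc[_ /= ?]; apply: tc.
    by split; [apply: K0|apply: D0] => /Kc[/= ? _]; apply: tc.
rewrite /Rintegral.
suff -> : (\int[mu]_x ('D_(pdir b) psi x)%:E = 0)%E by [].
case: b {dp cD ccD D0 slice_cont} iD slice_int => iD slice_int.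
- rewrite -(integral12_prod_meas1 iD).
  by under eq_integral do rewrite /fubini_F (slice_int (_, 0)); rewrite integral0.
- rewrite -(integral21_prod_meas1 iD).
  by under eq_integral do rewrite /fubini_G (slice_int (0, _)); rewrite integral0.
Qed.

End CompactSupport.

(** * Integration by parts and bump functions *)

Section IntegrationByParts.
Context {R : realType}.
Local Notation mu := (@leb2 R).
Local Notation T2 := (measurableTypeR R * measurableTypeR R)%type.
Local Notation meas2 := (@measurable _ T2).
Local Notation mfun2 := (@measurable_fun _ _ T2 R).
Implicit Types (U K : set (R * R)) (f g F phi psi : R * R -> R).

Lemma smooth_derivable b F x : smooth F -> derivable F x (pdir b).
Proof. by move=> /(_ [::])[_]; apply. Qed.

Lemma smooth_contD b F : smooth F -> continuous ('D_(pdir b) F).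
Proof. by move=> /(_ [:: b])[]. Qed.

Lemma integration_by_parts1 U b F phi : smooth F -> test_fun U phi ->
  \int[mu]_x (F x * 'D_(pdir b) phi x) = - \int[mu]_x ('D_(pdir b) F x * phi x).
Proof.
move=> sF tp; have sp := tp.1.
have ccp := test_fun_compactly_supp tp;
  have ccDp := test_fun_compactly_supp (test_fun_pderivs [:: b] tp).
have DE x : 'D_(pdir b) (fun x =>
  F x * phi x) x = F x * 'D_(pdir b) phi x + 'D_(pdir b) F x * phi x.
  rewrite (deriveM (smooth_derivable sF) (smooth_derivable sp)).
  by rewrite /GRing.scale /= [phi x * _]mulrC.
have i1 := compactly_supp_integrable (@measurableT _ T2) (compactly_suppM
  (smooth_cont sF) ccDp).
have i2 := compactly_supp_integrable (@measurableT _ T2) (compactly_suppM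
  (smooth_contD (b:=b) sF) ccp).
apply/eqP; rewrite -addr_eq0 -RintegralD//; apply/eqP.
have := @Rintegral_derive0 R b (fun x =>
  F x * phi x) (compactly_suppM (smooth_cont sF) ccp).
rewrite (_ : 'D_(pdir b) _ = fun x =>
  F x * 'D_(pdir b) phi x + 'D_(pdir b) F x * phi x); last exact/funext.
apply.
- move=> x; apply: derivableM; exact: smooth_derivable.
- move=> x; apply: cvgD; apply: cvgM.
  + exact: smooth_cont.
  + exact: smooth_contD.
  + exact: smooth_contD.
  + exact: smooth_cont.
Qed.

(** Integrating by parts moves the outermost derivative of phi first, which
    becomes the innermost one of F; hence [rev s]. *)
Lemma integration_by_partsn U s F phi : smooth F -> test_fun U phi ->
  \int[mu]_x (F x * pderivs s phi x) =
    (-1) ^+ size s * \int[mu]_x (pderivs (rev s) F x * phi x).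
Proof.
elim: s F => [|b s IH] F sF tp; first by rewrite expr0 mul1r.
rewrite [pderivs _ _]/= (integration_by_parts1 b sF (test_fun_pderivs s tp)).
rewrite (IH ('D_(pdir b) F)) //; last exact: (smooth_pderivs [:: b]).
by rewrite rev_cons -cats1 -pderivs_cat /= exprS mulN1r mulNr.
Qed.

Lemma Rintegral_test_fun U V f phi : test_fun U phi -> U `<=` V ->
  \int[mu]_(x in V) (f x * phi x) = \int[mu]_(x in U) (f x * phi x).
Proof.
move=> [sp [K [cK KU K0]]] UV; apply: Rintegral_support => // x _ Ux.
by rewrite K0 ?mulr0// => /KU.
Qed.

Lemma is_wderiv_smooth U s F : smooth F -> L2 U (pderivs (rev s) F) ->
  is_wderiv U s F (pderivs (rev s) F).
Proof.
move=> sF LF; split=> // phi tp.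
by rewrite -(Rintegral_test_fun F (test_fun_pderivs s tp)
  (@subsetT _ U)) -(Rintegral_test_fun _ tp (@subsetT _ U)) (integration_by_partsn s sF tp).
Qed.

Lemma is_wderiv_sub U V s f g : meas2 U -> meas2 V -> V `<=` U ->
  is_wderiv U s f g -> is_wderiv V s f g.
Proof.
move=> mU mV VU [Lg H]; split; first exact: L2S Lg.
move=> phi tp; rewrite -(Rintegral_test_fun f
  (test_fun_pderivs s tp) VU) -(Rintegral_test_fun g tp VU).
by apply: H; exact: test_fun_sub tp.
Qed.

Definition boxes : set (set (R * R)) := [set B | exists a b c d, B = obox a b c d].

Lemma oboxI (a b c d a' b' c' d' : R) : obox a b c d `&` obox a' b' c' d' =
  obox (Num.max a a') (Num.min b b') (Num.max c c') (Num.min d d').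
Proof.
apply/seteqP; split => x; rewrite /obox /= !gt_max !lt_min.
  by move=> [[/andP[-> ->] /andP[-> ->]] [/andP[-> ->] /andP[-> ->]]].
by move=> [/andP[/andP[-> ->] /andP[-> ->]] /andP[/andP[-> ->] /andP[-> ->]]].
Qed.

(** A strip is a countable union of boxes, so boxes generate the preimages of
    intervals under both projections. *)
Lemma measurable_boxes : (@measurable _ T2) = <<s boxes >>.
Proof.
apply/seteqP; split; last first.
  apply: smallest_sub; first exact: (@sigma_algebra_measurable _ T2).
  by move=> _ [a [b [c [d ->]]]]; exact: measurable_obox.
have E (x : R) : exists n : nat, - n%:R < x < n%:R.
  exists (Num.truncn `|x|).+1; rewrite -ltr_norml; exact: truncnS_gt.
apply: smallest_sub; first exact: smallest_sigma_algebra.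
rewrite subUset; split=> _ [A mA <-].
- have : measurable_fun setT (fst : g_sigma_algebraType boxes -> R).
    apply: (measurability _ (RGenOpens.measurableE R)).
    move=> _ [_ [a [b ->] <-]]; rewrite setTI.
    rewrite (_ : _ @^-1` _ = \bigcup_n obox a b (- n%:R) n%:R).
      apply: bigcupT_measurable => n; apply: sub_sigma_algebra.
      by exists a, b, (- n%:R), n%:R.
    apply/seteqP; split => [x /= |x [n _ [/= h _]]]; rewrite /= ?in_itv//= => h.
    by have [n hn] := E x.2; exists n.
  by move=> /(_ measurableT A mA).
- have : measurable_fun setT (snd : g_sigma_algebraType boxes -> R).
    apply: (measurability _ (RGenOpens.measurableE R)).
    move=> _ [_ [a [b ->] <-]]; rewrite setTI.
    rewrite (_ : _ @^-1` _ = \bigcup_n obox (- n%:R) n%:R a b).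
      apply: bigcupT_measurable => n; apply: sub_sigma_algebra.
      by exists (- n%:R), n%:R, a, b.
    apply/seteqP; split => [x /= |x [n _ [_ /= h]]]; rewrite /= ?in_itv//= => h.
    by have [n hn] := E x.1; exists n.
  by move=> /(_ measurableT A mA).
Qed.

Lemma compact_cbox (a b c d : R) : compact (cbox a b c d).
Proof.
rewrite cboxE; apply: compact_setX; exact: segment_compact.
Qed.

(** On ]a, b[ this is exp(-1/(k(t-a)) - 1/(k(b-t))), which increases to 1 as k
    tends to infinity. *)
Definition bump1 (a b k : R) (t : R) : R := theta ((t - a) * k) * theta ((t - b) * - k).

Lemma smooth_bump1 a b k : smooth1 (bump1 a b k).
Proof. by apply: smooth1M; apply: smooth1_affine; exact: smooth1_flat. Qed.

Lemma bump1_ge0 a b k t : 0 <= bump1 a b k t.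
Proof. by rewrite mulr_ge0 ?theta_ge0. Qed.

Lemma bump1_le1 a b k t : bump1 a b k t <= 1.
Proof. by rewrite mulr_ile1 ?theta_ge0 ?theta_le1. Qed.

Lemma bump1_out a b k t : 0 < k -> ~ (a < t < b) -> bump1 a b k t = 0.
Proof.
move=> k0 /negP; rewrite negb_and -!leNgt /bump1 => /orP[h|h].
  by rewrite theta_le0 ?mul0r// mulr_le0_ge0 ?subr_le0// ltW.
by rewrite [X in _ * X]theta_le0 ?mulr0// mulrN oppr_le0 mulr_ge0 ?subr_ge0// ltW.
Qed.

Lemma bump1_gt0 a b k t : 0 < k -> a < t < b -> 0 < bump1 a b k t.
Proof.
move=> k0 /andP[h1 h2]; rewrite mulr_gt0// theta_gt0//.
  by rewrite mulr_gt0// subr_gt0.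
by rewrite mulrN oppr_gt0 nmulr_rlt0// subr_lt0.
Qed.

Lemma theta_cvg (s : R) : 0 < s -> theta (s * n.+1%:R) @[n --> \oo] --> (1 : R).
Proof.
move=> s0; rewrite (_ : (fun n => _) = (fun n => expR (- (s^-1 * n.+1%:R^-1)))); last first.
  by apply/funext => n; rewrite thetaE mulr_gt0// invfM.
rewrite -[X in _ --> X]expR0; apply: continuous_cvg; first exact: continuous_expR.
rewrite -[X in _ --> X]oppr0; apply: cvgN.
rewrite -[X in _ --> X](mulr0 s^-1); apply: cvgM; first exact: cvg_cst.
exact: (@cvg_harmonic R).
Qed.

Lemma bump1_cvg a b t : a < t < b -> bump1 a b n.+1%:R t @[n --> \oo] --> (1 : R).
Proof.
move=> /andP[h1 h2]; rewrite -[X in _ --> X]mulr1; apply: cvgM.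
  by apply: theta_cvg; rewrite subr_gt0.
rewrite (_ : (fun n => _) = (fun n => theta ((b - t) * n.+1%:R))).
  by apply: theta_cvg; rewrite subr_gt0.
by apply/funext => n; rewrite mulrN -mulNr opprB.
Qed.

Definition bump2 (a b c d k : R) : R * R -> R :=
  fun x => bump1 a b k x.1 * bump1 c d k x.2.

Lemma bump2_tsum a b c d k :
  bump2 a b c d k = tsum (fun _ : 'I_1 => bump1 a b k) (fun _ => bump1 c d k).
Proof. by apply/funext => x; rewrite /tsum big_ord1. Qed.

Lemma bump2_out a b c d k x : 0 < k -> ~ obox a b c d x -> bump2 a b c d k x = 0.
Proof.
move=> k0 Bx; rewrite /bump2; have [h|h] := pselect (a < x.1 < b).
  by rewrite [X in _ * X]bump1_out ?mulr0// => h'; apply: Bx.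
by rewrite bump1_out ?mul0r.
Qed.

Lemma test_fun_bump2 U a b c d k : 0 < k -> cbox a b c d `<=` U ->
  test_fun U (bump2 a b c d k).
Proof.
move=> k0 BU; split.
  by rewrite bump2_tsum; apply: smooth_tsum => i; exact: smooth_bump1.
exists (cbox a b c d); split=> //; first exact: compact_cbox.
by move=> x Bx; apply: bump2_out => // /sub_obox_cbox.
Qed.

End IntegrationByParts.

(** * Uniqueness of weak derivatives *)

Section WeakDerivatives.
Context {R : realType}.
Local Notation mu := (@leb2 R).
Local Notation T2 := (measurableTypeR R * measurableTypeR R)%type.
Local Notation meas2 := (@measurable _ T2).
Local Notation mfun2 := (@measurable_fun _ _ T2 R).
Implicit Types (U K : set (R * R)) (f g F phi psi : R * R -> R).

Lemma L2_cst_box (a b c d k : R) : L2 (obox a b c d) (fun=> k).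
Proof.
have mB : meas2 (obox a b c d) := measurable_obox a b c d.
have mk : mfun2 (obox a b c d) (fun=> k) by exact: measurable_cst.
have [ab|ab] := ltP a b; last first.
  rewrite (_ : obox _ _ _ _ = set0) in mB mk *.
    apply/L2P => //; split=> //; exact: integrable_set0.
  apply/seteqP; split=> // x [/andP[h1 h2] _]; have := lt_trans h1 h2.
  by rewrite ltNge ab.
have [cd|cd] := ltP c d; last first.
  rewrite (_ : obox _ _ _ _ = set0) in mB mk *.
    apply/L2P => //; split=> //; exact: integrable_set0.
  apply/seteqP; split=> // x [_ /andP[h1 h2]]; have := lt_trans h1 h2.
  by rewrite ltNge cd.
by apply: (bounded_box_L2 (M := `|k|) (a := a) (b := b) (c := c) (d := d)).
Qed.

Lemma L2_box_integrable U g (a b c d : R) : meas2 U -> L2 U g -> obox a b c d `<=` U ->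
  mu.-integrable (obox a b c d) (EFin \o g).
Proof.
move=> mU Lg BU; have mB : meas2 (obox a b c d) := measurable_obox a b c d.
have := L2_mul_integrable mB (L2S mU mB BU Lg) (L2_cst_box a b c d 1).
by apply: eq_integrable => // x _; rewrite /= mulr1.
Qed.

Lemma bump2_ge0 (a b c d k : R) x : 0 <= bump2 a b c d k x.
Proof. by apply: mulr_ge0; exact: bump1_ge0. Qed.

Lemma bump2_le1 (a b c d k : R) x : bump2 a b c d k x <= 1.
Proof. by apply: mulr_ile1; rewrite ?bump1_ge0 ?bump1_le1. Qed.

(** The bumps supported in the closed box are bounded by 1 and converge to the
    indicator function of the open box. *)
Lemma integral_obox0 U g (a b c d : R) : meas2 U -> L2 U g ->
  (forall phi, test_fun U phi -> \int[mu]_(x in U) (g x * phi x) = 0) ->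
  cbox a b c d `<=` U -> (\int[mu]_(x in obox a b c d) (g x)%:E = 0)%E.
Proof.
move=> mU Lg H BU; have BU' : obox a b c d `<=` U.
  by move=> x /sub_obox_cbox/BU.
have mB : meas2 (obox a b c d) := measurable_obox a b c d.
have mg : mfun2 (obox a b c d) g by apply: L2_measurable; exact: L2S Lg.
have ig := L2_box_integrable mU Lg BU'.
pose G n := fun x : R * R => (g x * bump2 a b c d n.+1%:R x)%:E.
have tb n : test_fun U (bump2 a b c d n.+1%:R) by exact: test_fun_bump2.
have LU n : L2 U (bump2 a b c d n.+1%:R)
  by exact: compactly_supp_L2 (test_fun_compactly_supp (tb n)).
have iG n : mu.-integrable (obox a b c d) (G n).
  by apply: (L2_mul_integrable mB); [exact: L2S Lg|exact: L2S (LU n)].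
have G0 n : (\int[mu]_(x in obox a b c d) G n x = 0)%E.
  have := H _ (tb n); rewrite (Rintegral_support (V := obox a b c d))//; last first.
    by move=> x _ Bx; rewrite bump2_out ?mulr0.
  rewrite /Rintegral => h; rewrite -[LHS]fineK; last exact: integrable_fin_num (iG n).
  by rewrite h.
have cv : (\int[mu]_(x in obox a b c d)
  (G n x) @[n --> \oo] --> \int[mu]_(x in obox a b c d) (g x)%:E)%E.
  apply: (@dominated_cvg _ _ _ mu _ mB G (EFin \o g) (fun x => `|(g x)%:E|%E)) => //.
  - by move=> n; exact: measurable_int (iG n).
  - move=> x [h1 h2]; apply: cvg_EFin; first exact: nearW.
    rewrite /= -[X in _ --> X]mulr1; apply: cvgM; first exact: cvg_cst.
    by rewrite -[X in _ --> X]mulr1; apply: cvgM; exact: bump1_cvg.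
  - exact: integrable_abse.
  - move=> n x _; rewrite /G /= lee_fin normrM ler_piMr//.
    by rewrite (ger0_norm (bump2_ge0 _ _ _ _ _ _)) bump2_le1.
apply: (cvg_unique _ cv) => //.
rewrite (_ : (fun n => _) = (fun=> 0%E)); first exact: cvg_cst.
by apply/funext => n; exact: G0.
Qed.

(** The sets E for which the integral vanishes are stable under complements and
    countable disjoint unions, and they contain the boxes. *)
Lemma integral_obox_sub0 U g (a b c d : R) : meas2 U -> L2 U g ->
  (forall phi, test_fun U phi -> \int[mu]_(x in U) (g x * phi x) = 0) ->
  cbox a b c d `<=` U -> forall E, meas2 E ->
  (\int[mu]_(x in obox a b c d `&` E) (g x)%:E = 0)%E.
Proof.
move=> mU Lg H BU; have BU' : obox a b c d `<=` U.
  by move=> x /sub_obox_cbox/BU.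
set B := obox a b c d.
have mB : meas2 B := measurable_obox a b c d.
have ig := L2_box_integrable mU Lg BU'.
pose P E := (\int[mu]_(x in B `&` E) (g x)%:E = 0)%E; move=> E;
  rewrite measurable_boxes; move: E.
apply: (@dynkin_induction _ T2 boxes P); rewrite /P.
- exact: measurable_boxes.
- move=> _ _ [a1 [b1 [c1 [d1 ->]]]] [a2 [b2 [c2 [d2 ->]]]].
  by rewrite oboxI; do 4 eexists.
- by rewrite setIT; exact: integral_obox0 BU.
- move=> _ [a1 [b1 [c1 [d1 ->]]]]; rewrite oboxI.
  apply: (integral_obox0 mU Lg H) => x [/andP[h1 h2] /andP[h3 h4]]; apply: BU.
  by move: h1 h2 h3 h4;
    rewrite !ge_max !le_min => /andP[? _] /andP[? _] /andP[? _] /andP[? _]; split;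
    apply/andP.
- move=> S mS S0.
  have := integral_obox0 mU Lg H BU; rewrite -/B -{1}(setUIDK B S).
  rewrite integral_setU_EFin//=; last 4 first.
  + exact: measurableI.
  + exact: measurableD.
  + rewrite setUIDK; exact: L2_measurable (L2S mU mB BU' Lg).
  + by apply/disj_setPS => x [[_ ?] []].
  by rewrite S0 add0e setDE.
- move=> S mS tS S0; rewrite setI_bigcupr integral_bigcup//.
  + by rewrite eseries0// => n _ _; exact: S0.
  + exact: trivIset_setIl.
  + by move=> k; exact: measurableI.
  + apply: integrableS ig => //; first by apply: bigcupT_measurable => k;
      exact: measurableI.
    by move=> x [n _ []].
Qed.

(** Inside each rational box all integrals of g over measurable sets vanish, so
    that g is zero almost everywhere there; countably many boxes cover U. *)
Lemma fundamental_lemma U g : open U -> L2 U g ->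
  (forall phi, test_fun U phi -> \int[mu]_(x in U) (g x * phi x) = 0) ->
  {ae mu, forall x, U x -> g x = 0}.
Proof.
move=> oU Lg H; have mU : meas2 U := open_measurable2 oU.
have box0 q : crbox q `<=` U -> {ae mu, forall x, rbox q x -> g x = 0}.
  move=> qU; have qU' : rbox q `<=` U by move=> x /sub_obox_cbox/qU.
  have mB : meas2 (rbox q) := measurable_obox _ _ _ _.
  have := @integral_ae_eq _ _ _ mu _ mB (cst 0%E) _ (L2_box_integrable mU Lg qU')
    (measurable_cst _).
  move=> /(_ _)h; have {}h : ae_eq mu (rbox q) (EFin \o g) (cst 0%E).
    apply: h => E EB mE; rewrite integral_cst// mul0e.
    have := integral_obox_sub0 mU Lg H qU mE; by rewrite setIC setIidl.
  by apply: ae_leb2S h => x h /h /= [].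
(* The rational boxes are enumerated, since null sets are stable under countable
   unions only. *)
pose P (n : nat) (x : R * R) :=
  if (choice.unpickle n : option (rat * rat * (rat * rat))) is Some q then
  (crbox q `<=` U -> rbox q x -> g x = 0) else True.
have : {ae mu, forall x, forall n, P n x}.
  apply/ae_foralln => n; rewrite /P; case: (choice.unpickle n : option _) => [q|];
    last exact: aeW.
  have [qU|qU] := pselect (crbox q `<=` U); last exact: aeW.
  by apply: ae_leb2S (box0 q qU).
apply: ae_leb2S => x Px Ux; have [q [qx qU]] := open_rbox oU Ux.
by have := Px (choice.pickle q); rewrite /P choice.pickleK; apply.
Qed.

Lemma is_wderiv_unique U s f g1 g2 : open U -> is_wderiv U s f g1 -> is_wderiv U s f g2 ->
  {ae mu, forall x, U x -> g1 x = g2 x}.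
Proof.
move=> oU [L1 H1] [L2' H2]; have mU : meas2 U := open_measurable2 oU.
have : {ae mu, forall x, U x -> g1 x - g2 x = 0}.
  apply: fundamental_lemma => //; first exact: L2B.
  move=> phi tp; have Lp := compactly_supp_L2 mU (test_fun_compactly_supp tp).
  under eq_Rintegral do rewrite mulrBl.
  rewrite RintegralB//; try exact: L2_mul_integrable.
  have := H1 _ tp; rewrite (H2 _ tp) => /(congr1 (fun z => (-1) ^+ size s * z)).
  by rewrite !mulrA -expr2 -exprM mulnC exprM sqrrN expr1n expr1n !mul1r => ->;
    rewrite subrr.
by apply: ae_leb2S => x h Ux; apply/eqP; rewrite -subr_eq0 h.
Qed.

Lemma wderivP U s f g : is_wderiv U s f g -> is_wderiv U s f (wderiv U s f).
Proof. by move=> h; rewrite /wderiv; case: xgetP => [y -> //|/(_ g)]. Qed.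

Lemma wderiv_ae U s f g : open U -> is_wderiv U s f g ->
  {ae mu, forall x, U x -> wderiv U s f x = g x}.
Proof. by move=> oU h; exact: is_wderiv_unique (wderivP h) h. Qed.

Lemma test_fun_L2 U phi : meas2 U -> test_fun U phi -> L2 U phi.
Proof. by move=> mU /test_fun_compactly_supp; exact: compactly_supp_L2. Qed.

Lemma is_wderivB U s f1 g1 f2 g2 : meas2 U -> L2 U f1 -> L2 U f2 ->
  is_wderiv U s f1 g1 -> is_wderiv U s f2 g2 ->
  is_wderiv U s (f1 \- f2) (g1 \- g2).
Proof.
move=> mU Lf1 Lf2 [L1 H1] [L2' H2]; split; first exact: L2B.
move=> phi tp; have Lp := test_fun_L2 mU tp;
  have Lsp := test_fun_L2 mU (test_fun_pderivs s tp).
under eq_Rintegral do rewrite /= mulrBl.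
under [X in _ = _ * X]eq_Rintegral do rewrite /= mulrBl.
rewrite !RintegralB//; try exact: L2_mul_integrable.
by rewrite H1// H2// mulrBr.
Qed.

Lemma is_wderiv_ae U s f1 f2 g : meas2 U -> mfun2 U f1 -> mfun2 U f2 ->
  {ae mu, forall x, U x -> f1 x = f2 x} ->
  is_wderiv U s f1 g -> is_wderiv U s f2 g.
Proof.
move=> mU m1 m2 E [Lg H]; split=> // phi tp; rewrite -H//.
have mp := L2_measurable (test_fun_L2 mU (test_fun_pderivs s tp)).
apply: ae_eq_Rintegral => //; try exact: measurable_funM.
by apply: ae_leb2S E => x h Ux; rewrite h.
Qed.

End WeakDerivatives.

(** * Test functions and polynomials in the Sobolev spaces *)

Section SobolevMembers.
Context {R : realType}.
Local Notation mu := (@leb2 R).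
Local Notation T2 := (measurableTypeR R * measurableTypeR R)%type.
Local Notation meas2 := (@measurable _ T2).
Local Notation mfun2 := (@measurable_fun _ _ T2 R).
Implicit Types (U K : set (R * R)) (f g F phi psi v : R * R -> R).

(** A null set contains no box. *)
Lemma ae_open_ex U (P : R * R -> Prop) : {ae mu, forall x, P x} -> open U ->
  U !=set0 -> exists2 x, U x & P x.
Proof.
move=> [N [mN N0 NP]] oU [x Ux]; have [q [qx qU]] := open_rbox oU Ux.
apply: contrapT => nex.
have qN : rbox q `<=` N.
  move=> y qy; apply: NP => /= Py; apply: nex; exists y => //.
  exact/qU/sub_obox_cbox.
have := qx; rewrite /rbox /obox /= => -[/andP[a1 a2] /andP[b1 b2]].
have : (mu (rbox q) <= mu N)%E.
  have mB : meas2 (rbox q) := measurable_obox _ _ _ _.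
  by apply: le_measure => //; rewrite inE.
rewrite N0 leb2_obox ?(lt_trans a1 a2) ?(lt_trans b1 b2)// lee_fin.
by rewrite leNgt mulr_gt0// subr_gt0 ?(lt_trans a1 a2) ?(lt_trans b1 b2).
Qed.

Lemma L2norm_ae0 U f : meas2 U -> mfun2 U f -> {ae mu, forall x, U x -> f x = 0} ->
  L2norm U f = 0.
Proof.
move=> mU mf f0; apply/eqP; rewrite -sqrf_eq0.
have m0 : mfun2 U (fun=> 0) by exact: measurable_cst.
have L0 : L2 U (fun=> 0).
  by apply: (bounded_box_L2 (M := 0) (a := 0) (b := 1) (c := 0) (d := 1)) => //;
    rewrite ?normr0.
have Lf : L2 U f by apply: L2_ae L0 _ _ => //; apply: ae_leb2S f0 => x h Ux; rewrite h.
rewrite L2normE// (ae_eq_Rintegral (g := fun=> 0))//.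
- by rewrite /Rintegral integral0.
- exact: measurable_funX.
- by apply: ae_leb2S f0 => x h Ux; rewrite h// expr0n.
Qed.

Lemma is_wderiv_test_fun U V s phi : meas2 V -> test_fun U phi ->
  is_wderiv V s phi (pderivs (rev s) phi).
Proof.
move=> mV tp; apply: is_wderiv_smooth; first exact: tp.1.
exact: compactly_supp_L2 (test_fun_compactly_supp (test_fun_pderivs _ tp)).
Qed.

(** A test function approximates itself: the weak derivatives of phi - phi
    vanish almost everywhere, whatever representatives [wderiv] picks. *)
Lemma H0space_test_fun U m phi : open U -> test_fun U phi -> H0space m U phi.
Proof.
move=> oU tp; have mU : meas2 U := open_measurable2 oU; split.
  split; first exact: compactly_supp_L2 (test_fun_compactly_supp tp).
  by move=> s _; exists (pderivs (rev s) phi); exact: is_wderiv_test_fun tp.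
move=> eps e0; exists phi => //.
suff -> : Hnorm m U (phi \- phi) = 0 by [].
rewrite /Hnorm big1 ?sqrtr0// => k _; rewrite big1// => s _.
have Lp := compactly_supp_L2 mU (test_fun_compactly_supp tp).
have h := is_wderiv_test_fun s mU tp.
have hh := is_wderivB mU Lp Lp h h.
rewrite L2norm_ae0 ?expr0n//.
  exact: L2_measurable (wderivP hh).1.
by apply: ae_leb2S (wderiv_ae oU hh) => x hx Ux; rewrite hx//= subrr.
Qed.

(** Continuous functions that agree almost everywhere on U agree on U, because
    null sets have empty interior. *)
Lemma ptval_cont U v a : open U -> U a -> continuous v -> ptval U v a = v a.
Proof.
move=> oU Ua cv; rewrite /ptval; case: xgetP => [y _ [w [cw vw ->]]|]; last first.
  by move=> /(_ (v a)) []; exists v; split => //; exact: aeW.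
apply/eqP/negPn/negP => ne.
have cd : (v x - w x) @[x --> a] --> v a - w a.
  by apply: cvgB; [exact: cv|apply: cw; rewrite inE].
have nb : nbhs a [set x | v x - w x != 0 /\ U x].
  apply: filterI; last exact: open_nbhs_nbhs.
  have ne' : v a - w a != 0 by rewrite subr_eq0 eq_sym.
  apply: (cd [set y | y != 0]).
  by apply: open_nbhs_nbhs; split; [exact: open_neq|].
have := ae_open_ex vw (open_interior [set x | v x - w x != 0 /\ U x]) (ex_intro _ a nb).
by move=> [x /interior_subset[/= h1 Ux] /(_ Ux) h2]; rewrite h2 subrr eqxx in h1.
Qed.

(** The shape in which [pwpoly] presents polynomials of total degree at most k. *)
Definition poly2 (k : nat) (c : nat -> nat -> R) (x : R * R) : R :=
  \sum_(p < k.+1) \sum_(q < k.+1 | (p + q <= k)%N) c p q * x.1 ^+ p * x.2 ^+ q.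

Lemma poly2_tsum k c : poly2 k c = tsum
  (fun i : 'I_k.+1 * 'I_k.+1 =>
    horner ((if (i.1 + i.2 <= k)%N then c i.1 i.2 else 0) *: 'X^(i.1)))
  (fun i : 'I_k.+1 * 'I_k.+1 => horner 'X^(i.2)).
Proof.
apply/funext => x; rewrite /poly2 /tsum pair_big_dep /= big_mkcond /=.
apply: eq_bigr => -[p q] _ /=; rewrite !hornerE.
by case: ifP => _; rewrite ?mul0r.
Qed.

Lemma smooth_poly2 k c : smooth (poly2 k c).
Proof. by rewrite poly2_tsum; apply: smooth_tsum => i; exact: smooth1_poly. Qed.

Lemma derive1n_horner n (p : {poly R}) : derive1n n (horner p) = horner (p^`(n)).
Proof.
elim: n => [|n IH]; first by rewrite derivn0.
by rewrite derive1nS IH derivnS derivE.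
Qed.

Lemma pderivs_poly2 k c s : size s = k -> exists y, pderivs s (poly2 k c) = fun=> y.
Proof.
move=> sk; rewrite poly2_tsum pderivs_tsum; try by move=> i; exact: smooth1_poly.
have E : (count negb s + count id s = k)%N.
  by rewrite -sk addnC -(count_predC id s).
exists (\sum_(i : 'I_k.+1 * 'I_k.+1)
  ((if (i.1 + i.2 <= k)%N then c i.1 i.2 else 0) *: 'X^(i.1))^`(count negb s).[0] *
    ('X^(i.2))^`(count id s).[0]).
apply/funext => x; apply: eq_bigr => -[p q] _ /=; rewrite !derive1n_horner.
case: ifP => pq; last by rewrite scale0r !linear0 !horner0 !mul0r.
rewrite !derivnZ !hornerZ !derivnXn !hornerMn !hornerXn.
have [h1|h1] := ltnP p (count negb s); first by rewrite ffact_small// !mulr0n !mulr0 !mul0r.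
have [h2|h2] := ltnP q (count id s); first by rewrite (ffact_small h2)// !mulr0n !mulr0.
have -> : (p - count negb s = 0)%N by lia.
by have -> : (q - count id s = 0)%N by lia.
Qed.

Lemma L2_bdd_cst U y : meas2 U -> bounded_set U -> L2 U (fun=> y).
Proof.
move=> mU [M [_ HM]].
have [c c0 Uc] : exists2 c, 0 < c & U `<=` obox (- c) c (- c) c.
  exists (`|M| + 2); first by rewrite ltr_wpDl.
  move=> x Ux; have : `|x| <= `|M| + 1 by apply: HM => //; have := ler_norm M; lra.
  rewrite prod_normE ge_max !ler_norml => /andP[/andP[h1 h2] /andP[h3 h4]].
  by split; apply/andP; split; lra.
apply: (bounded_box_L2 (M := `|y|) (a := - c) (b := c) (c := - c) (d := c)) => //.
- by rewrite gtrN.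
- by rewrite gtrN.
- by move=> x /Uc.
Qed.

(** Derivatives of order k of a polynomial of degree at most k are constant. *)
Lemma is_wderiv_poly2 U k c s f : open U -> bounded_set U -> size s = k -> mfun2 U f ->
  {ae mu, forall x, U x -> f x = poly2 k c x} ->
  exists y, is_wderiv U s f (fun=> y).
Proof.
move=> oU bU sk mf fE; have mU : meas2 U := open_measurable2 oU.
have [|y Ey] := @pderivs_poly2 k c (rev s); first by rewrite size_rev.
exists y; rewrite -Ey; apply: (is_wderiv_ae (f1 := poly2 k c)) => //.
- by apply: continuous_measurable2 => //; exact: smooth_cont (smooth_poly2 _ _).
- by apply: ae_leb2S fE => x h Ux; rewrite h.
- by apply: is_wderiv_smooth; [exact: smooth_poly2|rewrite Ey; exact: L2_bdd_cst].
Qed.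

End SobolevMembers.

(** * Geometry of the triangulation *)

Section Geometry.
Context {R : realType}.
Implicit Types (V : 'I_3 -> R * R) (x c : R * R) (U K : set (R * R)).

Lemma near0_pos (P : R -> Prop) : (\forall t \near 0, P t) ->
  exists2 t, 0 < t & P t.
Proof.
move=> /nbhs_ballP[e /= e0 H]; exists (e / 2); first by rewrite divr_gt0.
by apply: H; rewrite /ball/= sub0r normrN gtr0_norm ?divr_gt0//; lra.
Qed.

Lemma cvg_line1 (u w : R) : u + t * w @[t --> (0 : R)] --> u.
Proof.
have : u + t * w @[t --> (0 : R)] --> u + 0 * w.
  apply: (@cvgD _ _ _ (nbhs (0:R)) _ (fun=> u) (fun t => t * w)).
    exact: cvg_cst.
  apply: (@cvgM _ _ (nbhs (0:R)) _ id (fun=> w)).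
    exact: cvg_id.
  exact: cvg_cst.
by rewrite mul0r addr0.
Qed.

Lemma cvg_line2 x (w1 w2 : R) : (x.1 + t * w1, x.2 + t * w2) @[t --> (0 : R)] --> x.
Proof. by case: x => a b; exact: (cvg_pair (@cvg_line1 a w1) (@cvg_line1 b w2)). Qed.

Lemma big_ord3 (F : 'I_3 -> R) : \sum_k F k = F ord0 + F (inord 1) + F (inord 2).
Proof.
rewrite !big_ord_recl big_ord0 addr0 addrA; congr (_ + F _ + F _); apply/val_inj;
  by rewrite /= inordK.
Qed.

Lemma affine_free V (d : 'I_3 -> R) : Defs.nondegenerate V -> \sum_k d k = 0 ->
  \sum_k d k * (V k).1 = 0 -> \sum_k d k * (V k).2 = 0 -> forall k, d k = 0.
Proof.
rewrite /Defs.nondegenerate !big_ord3; set p := V ord0; set q := V (inord 1);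
  set r := V (inord 2).
set d0 := d ord0; set d1 := d (inord 1); set d2 := d (inord 2) => /= nd h0 h1 h2.
have d1E : d1 = 0.
  apply: (mulIf nd); rewrite mul0r.
  transitivity ((r.2 - p.2) * (d0 * p.1 + d1 * q.1 + d2 * r.1 - (d0 + d1 + d2) * p.1)
    - (r.1 - p.1) * (d0 * p.2 + d1 * q.2 + d2 * r.2 - (d0 + d1 + d2) * p.2)); first by ring.
  by rewrite h0 h1 h2; ring.
have d2E : d2 = 0.
  apply: (mulIf nd); rewrite mul0r.
  transitivity ((q.1 - p.1) * (d0 * p.2 + d1 * q.2 + d2 * r.2 - (d0 + d1 + d2) * p.2)
    - (q.2 - p.2) * (d0 * p.1 + d1 * q.1 + d2 * r.1 - (d0 + d1 + d2) * p.1)); first by ring.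
  by rewrite h0 h1 h2; ring.
have d0E : d0 = 0 by move: h0; rewrite d1E d2E !addr0.
move=> k; have : k \in [:: ord0; inord 1; inord 2].
  rewrite !inE -!(inj_eq val_inj) /= !inordK//.
  by case: k => [[|[|[|]]]].
by rewrite !inE => /or3P[] /eqP ->.
Qed.

(** A point of the face has barycentric coordinate 0 at some vertex outside S.
    Moving away from that vertex makes this coordinate negative, which means
    leaving the triangle. *)
Lemma face_not_interior V (S : {set 'I_3}) x : Defs.nondegenerate V -> (#|S| <= 2)%N ->
  hull S V x -> ~ (triangle V)° x.
Proof.
move=> nd S2 [l [l0 l1 x1 x2]] ix.
have [k kS] : exists k, k \notin S.
  apply/existsP; rewrite -negb_forall; apply/negP => /forallP h.
  have : S = [set: 'I_3]%SET by apply/setP => j; rewrite h inE.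
  by move=> ES; move: S2; rewrite ES cardsT card_ord.
pose l' j := if j \in S then l j else 0.
have sumS (F : 'I_3 -> R) : \sum_(j in S) l j * F j = \sum_j l' j * F j.
  rewrite [LHS]big_mkcond; apply: eq_bigr => j _; rewrite /l'.
  by case: ifP => // _; rewrite mul0r.
have l'1 : \sum_j l' j = 1.
  by rewrite -l1 [RHS]big_mkcond.
have : \forall t \near (0 :
  R), triangle V (x.1 + t * (x.1 - (V k).1), x.2 + t * (x.2 - (V k).2)).
  have cx : (x.1 + t * (x.1 - (V k).1), x.2 + t * (x.2 - (V k).2)) @[t --> (0:R)] --> x.
    exact: cvg_line2.
  exact: cx.
move=> /near0_pos[t t0 [mm [m0 m1 mx1 mx2]]].
have E (F : 'I_3 -> R) : \sum_(j in [set: 'I_3]%SET) F j = \sum_j F j.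
  by apply: eq_bigl => j; rewrite inE.
rewrite !E in m1 mx1 mx2; rewrite !sumS in x1 x2; rewrite /= in mx1 mx2.
have dE (F : 'I_3 -> R) : \sum_j (mm j - l' j - t * (l' j - (j == k)%:R)) * F j =
  \sum_j mm j * F j - \sum_j l' j * F j - t * (\sum_j l' j * F j - F k).
  rewrite -[F k]mul1r -(_ : \sum_j (j == k)%:R * F j = 1 * F k); last first.
    by rewrite (bigD1 k)//= eqxx big1 ?addr0// => j /negbTE ->; rewrite mul0r.
  rewrite -!sumrB mulr_sumr -sumrB; apply: eq_bigr => j _; ring.
have := @affine_free V (fun j => mm j - l' j - t * (l' j - (j == k)%:R)) nd _ _ _ k.
rewrite !dE -!mx1 -!mx2 -!x1 -!x2 /l' (negbTE kS) eqxx.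
have -> : \sum_k0 (mm k0 - l' k0 - t * (l' k0 - (k0 == k)%:R)) = 0.
  have := dE (fun=> 1); under eq_bigr do rewrite mulr1.
  move=> ->; under eq_bigr do rewrite mulr1.
  under [X in _ - X - _]eq_bigr do rewrite mulr1.
  under [X in _ - _ - t * (X - _)]eq_bigr do rewrite mulr1.
  by rewrite m1 l'1; ring.
move=> /(_ erefl)H; have {H} : mm k - 0 - t * (0 - 1) = 0 by apply: H; ring.
by have := m0 k; lra.
Qed.

Lemma hull_vertex V (S : {set 'I_3}) k : k \in S -> hull S V (V k).
Proof.
move=> kS; exists (fun j => (j == k)%:R); split.
- by move=> j; rewrite ler0n.
- by rewrite (bigD1 k)//= eqxx big1 ?addr0// => j /andP[_ /negbTE ->].
- by rewrite (bigD1 k)//= eqxx mul1r big1 ?addr0// => j /andP[_ /negbTE ->]; rewrite mul0r.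
- by rewrite (bigD1 k)//= eqxx mul1r big1 ?addr0// => j /andP[_ /negbTE ->]; rewrite mul0r.
Qed.

Lemma interiors_disjoint U n (T : 'I_n -> 'I_3 -> R * R) i j x :
  triangulation U T -> i != j -> (tri T i)° x -> ~ (tri T j)° x.
Proof.
move=> [nd _ H] ij ix jx; have [S [S' [S2 _ E _]]] := H i j ij.
apply: (@face_not_interior (T i) S x) => //; rewrite -E.
by split; exact: interior_subset.
Qed.

(** A vertex of another triangle meets this one in a face spanned by at most two
    vertices.  This is why point forces do not see functions supported inside a
    triangle. *)
Lemma vertex_not_interior U n (T : 'I_n -> 'I_3 -> R * R) i a :
  triangulation U T -> interior_vertex U T a -> ~ (tri T i)° a.
Proof.
move=> [nd _ H] [_ [j [k ->]]] ix; have [ij|ij] := eqVneq i j.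
  rewrite -ij in ix *; apply: (@face_not_interior (T i) [set k]%SET (T i k)) => //.
    by rewrite cards1.
  by apply: hull_vertex; rewrite inE.
have [S [S' [S2 _ E _]]] := H i j ij.
apply: (@face_not_interior (T i) S (T j k)) => //; rewrite -E.
by split; [exact: interior_subset|apply: hull_vertex; rewrite inE].
Qed.

(** In the frame at a boundary point x, the points just below x have
    neighbourhoods below the graph, outside U; so x is not interior to the
    closure of U. *)
Lemma lipschitz_interior_closure U : open U -> lipschitz_boundary U ->
  (closure U)° `<=` U.
Proof.
move=> oU lU x ix; apply: contrapT => Ux.
have : bd U x by split; [exact: interior_subset|rewrite (interior_id _).1].
move=> /lU[e [r [gam [e1 r0 lg H]]]].
have cg : continuous gam.
  have [M [Mr HM]] := lg.
  have {}HM := HM (Num.max M 0 + 1) _.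
  have k0 : 0 < Num.max M 0 + 1 by rewrite ltr_wpDl// le_max lexx orbT.
  move=> a; apply/cvgrPdist_le => eps eps0; near=> b.
  apply: (le_trans (HM _ (a, b) _)); rewrite ?ltr_pwDr ?le_max ?lexx//=.
  rewrite -ler_pdivlMl// mulrC; near: b.
  apply/nbhs_ballP; exists (eps / (Num.max M 0 + 1)); first by rewrite /= divr_gt0.
  by move=> c; rewrite /ball/= => /ltW.
pose s (y : R * R) := (y.1 - x.1) * e.1 + (y.2 - x.2) * e.2.
pose t (y : R * R) := (y.2 - x.2) * e.1 - (y.1 - x.1) * e.2.
have cs : continuous s.
  move=> y; apply: cvgD; apply: cvgM; try exact: cvg_cst.
    by apply: cvgB; [exact: cvg_fst|exact: cvg_cst].
  by apply: cvgB; [exact: cvg_snd|exact: cvg_cst].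
have ct : continuous t.
  move=> y; apply: cvgB; apply: cvgM; try exact: cvg_cst.
    by apply: cvgB; [exact: cvg_snd|exact: cvg_cst].
  by apply: cvgB; [exact: cvg_fst|exact: cvg_cst].
have g0 : 0 <= gam 0.
  have := H x; rewrite /= !subrr !mul0r addr0 subr0 normr0 => /(_ r0 r0)h.
  by rewrite leNgt; apply/negP => /h.
(* The point at distance tau straight below x in the local frame. *)
pose z (tau : R) : R * R := (x.1 + tau * e.2, x.2 - tau * e.1).
have sz tau : s (z tau) = 0 by rewrite /s /=; ring.
have tz tau : t (z tau) = - tau by rewrite /t /= -[RHS]mulr1 -e1; ring.
have [tau [/andP[tau0 taur] ztau]] : exists tau : R, 0 < tau < r /\ closure U (z tau).
  have zx : z tau @[tau --> (0:R)] --> x.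
    have := @cvg_line2 x e.2 (- e.1); rewrite /z.
    by under eq_fun do rewrite mulrN.
  have : \forall tau \near (0:R), tau < r /\ closure U (z tau).
    by near=> tau; split; near: tau; [exact: lt_nbhsl|exact: zx].
  by move=> /near0_pos[tau tau0 [taur cz]]; exists tau; rewrite tau0 taur.
have nz : nbhs (z tau) [set y | [/\ `|s y| < r, `|t y| < r & 0 < gam (s y) - t y]].
  have cn (f : R * R -> R) : continuous f -> `|f (z tau)| < r ->
    \forall y \near z tau, `|f y| < r.
    move=> cf fr; have : (`|f y| : R) @[y --> z tau] --> `|f (z tau)|.
      by apply: cvg_norm; exact: cf.
    by move=> H1; apply: (H1 [set u | u < r]); exact: lt_nbhsl.
  have n1 := cn _ cs; have n2 := cn _ ct.
  have n3 : \forall y \near z tau, 0 < gam (s y) - t y.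
    have : gam (s y) - t y @[y --> z tau] --> gam (s (z tau)) - t (z tau).
      apply: cvgB; last exact: ct.
      by apply: (continuous_comp (cs _)); exact: cg.
    move=> H1; apply: (H1 [set u | 0 < u]); apply: lt_nbhsr.
    by rewrite sz tz opprK ltr_wpDl.
  rewrite sz normr0 in n1; rewrite tz normrN gtr0_norm// in n2.
  by apply: filterS3 (n1 r0) (n2 taur) n3.
have [y [Uy [/= sr tr gt]]] := ztau _ nz.
have h1 : gam (s y) < t y by apply/(H y sr tr).
by move: gt; rewrite subr_gt0 => /(lt_trans h1); rewrite ltxx.
Unshelve. all: by end_near.
Qed.

Lemma sup_gt0_has_sup (A : set R) : 0 < sup A -> has_sup A.
Proof. by move=> h; apply: contrapT => /sup_out h'; rewrite h' ltxx in h. Qed.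

Lemma le_edist x c : `|x.1 - c.1| <= Defs.edist x c /\ `|x.2 - c.2| <= Defs.edist x c.
Proof.
by rewrite -!sqrtr_sqr /Defs.edist !ler_sqrt ?addr_ge0 ?sqr_ge0// lerDl lerDr !sqr_ge0.
Qed.

Lemma diam_box K x c : 0 < diam K -> K x -> K c ->
  `|x.1 - c.1| <= diam K /\ `|x.2 - c.2| <= diam K.
Proof.
move=> d0 Kx Kc; have [h1 h2] := le_edist x c.
have h3 : Defs.edist x c <= diam K.
  by apply: ub_le_sup; [exact: (sup_gt0_has_sup d0).2|exists x, c].
by split; [exact: le_trans h1 h3|exact: le_trans h2 h3].
Qed.

(** K contains a disc of radius r with 4 r > indiam K.  The square of half-side
    rho around its centre, enlarged by rho on all sides, is still contained in
    the disc, since 4 rho <= r. *)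
Lemma square_in_shape_regular K (sigma : R) : 0 < diam K ->
  diam K <= sigma * indiam K ->
  let rho := diam K / (16 * `|sigma| + 1) in
  exists c, [/\ K c, cbox (c.1 - rho) (c.1 + rho) (c.2 - rho) (c.2 + rho) `<=` K° &
    K `<=` cbox (c.1 - diam K) (c.1 + diam K) (c.2 - diam K) (c.2 + diam K)].
Proof.
move=> d0 dK rho.
have i_ge0 : 0 <= indiam K.
  rewrite leNgt; apply/negP => i0; have : has_sup [set d | exists c r,
    [/\ 0 <= r, [set x | Defs.edist x c <= r] `<=` K & d = 2 * r]].
    by apply: contrapT => /sup_out h; move: i0; rewrite /indiam h ltxx.
  move=> [[d [c [r [r0 Kr dr]]]] hub].
  have : d <= indiam K by apply: ub_le_sup => //; exists c, r.
  by rewrite leNgt (lt_le_trans i0)// dr mulr_ge0.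
have [i0 s0] : 0 < indiam K /\ 0 < sigma.
  have h : 0 < sigma * indiam K by exact: lt_le_trans dK.
  have i0 : 0 < indiam K.
    by rewrite lt_neqAle i_ge0 andbT eq_sym; apply/eqP => E; move: h; rewrite E mulr0 ltxx.
  by split=> //; rewrite -(pmulr_lgt0 _ i0).
have hs := sup_gt0_has_sup i0.
have [_ [c [r [r0 Kr ->]]] rI] := sup_adherent (divr_gt0 i0 (ltr0Sn R 1)) hs.
have {}rI : indiam K < 4 * r by move: rI; rewrite -/(indiam K); lra.
have rho0 : 0 < rho by rewrite divr_gt0// ltr_wpDl// mulr_ge0.
have rrho : 4 * rho <= r.
  have E : rho * (16 * sigma + 1) = diam K.
    by rewrite /rho (gtr0_norm s0) divfK// gt_eqF// ltr_wpDl// mulr_ge0// ltW.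
  have : rho * (16 * sigma) <= sigma * (4 * r).
    apply: (le_trans (y := diam K)); first by rewrite -E; nra.
    by apply: (le_trans dK); rewrite ler_pM2l// ltW.
  by rewrite (_ : rho * (16 * sigma) = sigma * (16 * rho)); [rewrite ler_pM2l//; lra|ring].
have Kc : K c by apply: Kr; rewrite /= /Defs.edist !subrr expr0n /= addr0 sqrtr0.
exists c; split=> //.
- move=> x [/andP[x1 x2] /andP[x3 x4]].
  apply/nbhs_ballP; exists rho => //= y [/=].
  rewrite /ball/= !ltr_norml => /andP[y1 y2] /andP[y3 y4]; apply: Kr => /=.
  rewrite /Defs.edist -(ger0_norm r0) -sqrtr_sqr ler_sqrt ?sqr_ge0//.
  have h1 : `|y.1 - c.1| <= r / 2 by rewrite ler_norml; apply/andP; split; lra.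
  have h2 : `|y.2 - c.2| <= r / 2 by rewrite ler_norml; apply/andP; split; lra.
  rewrite -(real_normK (num_real (y.1 - c.1))) -(real_normK (num_real (y.2 - c.2))).
  have := normr_ge0 (y.1 - c.1); have := normr_ge0 (y.2 - c.2); nra.
- move=> x Kx; have [] := diam_box d0 Kx Kc.
  by rewrite !ler_norml => /andP[? ?] /andP[? ?]; split; apply/andP; split; lra.
Qed.

End Geometry.

(** * A system of bump functions dual to the monomials *)

Section DualSystem.
Context {R : realType}.
Local Notation leb := (@lebesgue_measure R).
Local Notation I01 := [set` `[(-1 : R), (1 : R)]].
Implicit Types f g : R -> R.

Lemma continuous_itv_integrable (a b : R) f : continuous f ->
  leb.-integrable `[a, b] (EFin \o f).
Proof.
move=> cf; apply: continuous_compact_integrable; first exact: segment_compact.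
exact: continuous_subspaceT.
Qed.

Lemma Rintegral_sum d (T : measurableType d) (nu : {measure set T -> \bar R}) (D : set T)
    (I : Type) (r : seq I) (h : I -> T -> R) : measurable D ->
  (forall i, nu.-integrable D (EFin \o h i)) ->
  nu.-integrable D (EFin \o (fun x => \sum_(i <- r) h i x)) /\
  \int[nu]_(x in D) (\sum_(i <- r) h i x) = \sum_(i <- r) \int[nu]_(x in D) h i x.
Proof.
move=> mD H; elim: r => [|i r [IH1 IH2]].
  rewrite big_nil; under [X in EFin \o X]eq_fun do rewrite big_nil.
  under eq_Rintegral do rewrite big_nil.
  by split; [exact: integrable0|rewrite /Rintegral integral0].
rewrite big_cons; under [X in EFin \o X]eq_fun do rewrite big_cons.
under eq_Rintegral do rewrite big_cons.
split; last by rewrite RintegralD// IH2.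
by have := integrableD mD (H i) IH1; apply: eq_integrable.
Qed.

Definition eta : R -> R := bump1 (-1) 1 1.

Lemma smooth_eta : smooth1 eta.
Proof. exact: smooth_bump1. Qed.

Lemma finite_roots (p : {poly R}) : p != 0 -> finite_set [set t : R | root p t].
Proof.
elim: {p}(size p) {-2}p (leqnn (size p)) => [|n IH] p sp pn0.
  by move: sp; rewrite leqn0 size_poly_eq0 (negbTE pn0).
have [[a ra]|nr] := pselect (exists a, root p a); last first.
  rewrite (_ : [set _ | _] = set0)//; apply/seteqP; split=> // t rt.
  by apply: nr; exists t.
have /factor_theorem[q pE] := ra.
have qn0 : q != 0 by apply: contraNneq pn0 => q0; rewrite pE q0 mul0r.
have sq : (size q <= n)%N.
  by move: sp; rewrite pE size_Mmonic ?monicXsubC// size_XsubC addn2.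
rewrite (_ : [set _ | _] = [set a] `|` [set t | root q t]).
  by rewrite finite_setU; split; [exact: finite_set1|exact: IH].
apply/seteqP; split=> t /=; rewrite pE rootM root_XsubC.
  by move=> /orP[|/eqP]; [right|left].
by move=> [->|->] //; rewrite eqxx orbT.
Qed.

(** The integrand is nonnegative, so p vanishes almost everywhere on ]-1, 1[,
    whereas a nonzero polynomial has finitely many roots. *)
Lemma eta_poly_eq0 (p : {poly R}) :
  \int[leb]_(t in I01) (eta t * p.[t] ^+ 2) = 0 -> p = 0.
Proof.
move=> I0.
have ci : continuous (fun t => eta t * p.[t] ^+ 2).
  move=> t; apply: cvgM; first exact: (smooth1_cont smooth_eta).
  by under eq_fun do rewrite expr2; apply: cvgM; exact: continuous_horner.
have ii := continuous_itv_integrable (-1) 1 ci.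
have mI : measurable (I01 : set (measurableTypeR R)) by exact: measurable_itv.
have E0 : (\int[leb]_(t in I01) `|(EFin \o (fun t => (eta t * p.[t] ^+ 2)%R)) t| = 0)%E.
  under eq_integral.
    move=> t _; rewrite /= ger0_norm; last by rewrite mulr_ge0 ?sqr_ge0 ?bump1_ge0.
    over.
  have fin := integrable_fin_num mI ii.
  by rewrite -[LHS]fineK// -[fine _]/(Rintegral _ _ _) I0.
have /ae_eq_integral_abs : measurable_fun (I01 :
  set (measurableTypeR R)) (EFin \o (fun t =>
  eta t * p.[t] ^+ 2)) by exact: measurable_int ii.
move=> /(_ leb mI)[/(_ E0) [N [mN N0 HN]] _].
apply/eqP/negPn/negP => pn0.
pose Z := [set t : R | root p t].
have fZ : finite_set Z := finite_roots pn0.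
have Z0 : leb Z = 0%E by apply: countable_lebesgue_measure0; exact: finite_set_countable.
have mZ : measurable (Z :
  set (measurableTypeR R)) by exact: countable_measurable (finite_set_countable fZ).
have sub : `](-1 : R), (1 : R)[%classic `<=` N `|` Z.
  move=> t; rewrite /= in_itv/= => t11.
  have [rt|rt] := boolP (root p t); first by right.
  left; apply: HN => /= h.
  have tI : (t \in `[-1, 1]) by rewrite in_itv/=; move: t11 => /andP[? ?]; rewrite !ltW.
  move: (h tI) => /= [] /eqP; rewrite mulf_eq0 expf_eq0 /= => /orP[|pt].
    by rewrite gt_eqF// bump1_gt0.
  by move/negP: rt; apply; exact: pt.
have : (leb ([set` `](-1 : R), (1 : R)[%R] : set R) <= leb (N `|` Z))%E.
  by apply: le_measure => //; rewrite inE//; exact: measurableU.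
rewrite measureU0// N0 lebesgue_measure_itv/= lte_fin ifT; last by lra.
by rewrite -EFinB lee_fin; lra.
Qed.

(** The Gram matrix M of the monomials for the weight eta is invertible: if
    a M = 0 and p has coefficients a, then the integral of eta p^2 vanishes.  The
    rows of the inverse are the coefficients of the dual functions with respect
    to the functions eta t^j. *)
Lemma dual_system (m : nat) : exists psi : 'I_m.+1 -> R -> R,
  [/\ forall i, smooth1 (psi i),
      forall i t, ~ (-1 < t < 1) -> psi i t = 0 &
      forall i k : 'I_m.+1, \int[leb]_(t in I01) (psi i t * t ^+ k) = (i == k)%:R].
Proof.
pose M : 'M[R]_m.+1 := \matrix_(i, j) \int[leb]_(t in I01) (eta t * t ^+ (i + j)).
have cM k : continuous (fun t : R => eta t * t ^+ k).
  move=> t; apply: cvgM; first exact: (smooth1_cont smooth_eta).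
  exact: exprn_continuous.
have mI : measurable (I01 : set (measurableTypeR R)) by exact: measurable_itv.
have uM : M \in unitmx.
  rewrite -row_free_unit -kermx_eq0; apply/eqP/row_matrixP => r; rewrite row0.
  set a := row r (kermx M).
  have aM : a *m M = 0 by rewrite -row_mul mulmx_ker row0.
  pose p := \poly_(j < m.+1) a 0 (inord j).
  have pE t : p.[t] = \sum_(j < m.+1) a 0 j * t ^+ j.
    by rewrite horner_poly; apply: eq_bigr => j _; rewrite inord_val.
  have p0 : p = 0.
    apply: eta_poly_eq0; transitivity ((a *m M *m a^T) 0 0); last first.
      by rewrite aM mul0mx mxE.
    have cE j i : continuous (fun t => a 0 j * a 0 i * (eta t * t ^+ (i + j))).
      by move=> t; apply: cvgM; [exact: cvg_cst|exact: cM].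
    transitivity (\int[leb]_(t in I01) \sum_(j < m.+1) \sum_(i < m.+1)
       (a 0 j * a 0 i * (eta t * t ^+ (i + j)))).
      apply: eq_Rintegral => t _; rewrite expr2 !pE big_distrlr /= mulr_sumr.
      apply: eq_bigr => j _; rewrite mulr_sumr; apply: eq_bigr => i _.
      by rewrite exprD; ring.
    rewrite mxE (Rintegral_sum _ mI _).2; last first.
      by move=> j; apply: (Rintegral_sum _ mI _).1 => i; exact: continuous_itv_integrable.
    apply: eq_bigr => j _; rewrite (Rintegral_sum _ mI _).2; last by move=> i;
      exact: continuous_itv_integrable.
    rewrite !mxE mulr_suml; apply: eq_bigr => i _.
    by rewrite !mxE RintegralZl//; [ring|exact: continuous_itv_integrable].
  apply/rowP => j; rewrite [RHS]mxE.
  by have := congr1 (fun q : {poly R} => q`_j) p0;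
    rewrite /p coef_poly ltn_ord inord_val coef0.
exists (fun i t => \sum_j invmx M i j * (eta t * t ^+ j)); split.
- move=> i; have sj (j : 'I_m.+1) : smooth1 (fun t => invmx M i j * (eta t * t ^+ j)).
    apply: smooth1M; first exact: smooth1_cst.
    apply: smooth1M; first exact: smooth_eta.
    by have := smooth1_poly ('X^j : {poly R}); congr smooth1; apply/funext => t;
      rewrite hornerXn.
  elim: (index_enum _) => [|j r IH].
    by under eq_fun do rewrite big_nil; exact: smooth1_cst.
  by under eq_fun do rewrite big_cons; exact: smooth1D.
- move=> i t tn; rewrite big1// => j _.
  by rewrite /eta bump1_out// mul0r mulr0.
- move=> i k.
  transitivity ((invmx M *m M) i k); last by rewrite mulVmx// mxE.
  rewrite mxE -[RHS](_ :
    \sum_j \int[leb]_(t in I01) (invmx M i j * (eta t * t ^+ (j + k))) = _).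
    rewrite -(Rintegral_sum _ mI _).2; last first.
      by move=> j; apply: continuous_itv_integrable => t; apply: cvgM;
        [exact: cvg_cst|exact: cM].
    apply: eq_Rintegral => t _; rewrite mulr_suml; apply: eq_bigr => j _.
    by rewrite exprD !mulrA.
  apply: eq_bigr => j _; rewrite RintegralZl ?mxE//; exact: continuous_itv_integrable.
Qed.

End DualSystem.

(** * Scaled integrals over squares *)

Section Squares.
Context {R : realType}.
Local Notation leb := (@lebesgue_measure R).
Local Notation mu := (@leb2 R).
Local Notation T2 := (measurableTypeR R * measurableTypeR R)%type.
Local Notation meas2 := (@measurable _ T2).
Local Notation mfun2 := (@measurable_fun _ _ T2 R).
Implicit Types (U K : set (R * R)).

Lemma Rintegral_affine (f : R -> R) (c rho : R) : 0 < rho -> continuous f ->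
  \int[leb]_(x in [set` `[c - rho, c + rho]]) f ((x - c) * rho^-1) =
  rho * \int[leb]_(t in [set` `[(-1 : R), (1 : R)]]) f t.
Proof.
move=> r0 cf; pose F (x : R) := (x - c) * rho^-1.
have rn0 : rho != 0 by rewrite gt_eqF.
have dF x : is_derive x (1 : R) F rho^-1.
  have := @is_derive_affine R id c rho^-1 1 x (is_derive_id _ _).
  by rewrite mulr1.
have [dF1 dF2] := is_derive_derive1 (f' := fun=> rho^-1) dF.
have Fa : F (c - rho) = -1 by rewrite /F; field.
have Fb : F (c + rho) = 1 by rewrite /F; field.
have cF : continuous F by move=> x; apply/differentiable_continuous/derivable1_diffP.
have := @integration_by_substitution_increasing R F f (c - rho) (c + rho).
rewrite Fa Fb => /(_ _ _ _ _ _ _ _)E.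
have {}E : (\int[leb]_(x in [set` `[(-1)%R, 1%R]]) (f x)%:E =
  \int[leb]_(x in [set` `[(c - rho)%R, (c + rho)%R]]) (rho^-1 * (f \o F) x)%:E)%E.
  rewrite E.
  - by apply: eq_integral => x _; rewrite dF2 /= mulrC.
  - by move: r0; clear; lra.
  - by move=> x y _ _ xy; rewrite /F ltr_pM2r ?invr_gt0// ltrD2r.
  - by move=> x _; rewrite dF2; exact: cvg_cst.
  - by rewrite dF2; exact: is_cvg_cst.
  - by rewrite dF2; exact: is_cvg_cst.
  - split; first by move=> x _.
      by apply: cvg_at_right_filter; exact: cF.
    by apply: cvg_at_left_filter; exact: cF.
  - exact: continuous_subspaceT.
have cfF : continuous (f \o F) by move=> x; apply: continuous_comp; [exact: cF|exact: cf].
rewrite {2}/Rintegral E -[fine _]/(Rintegral _ _ _).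
rewrite RintegralZl//; last exact: continuous_itv_integrable.
by rewrite mulrA divff// mul1r.
Qed.

Lemma Rintegral_prod (f g : R -> R) (a b c d : R) : continuous f -> continuous g ->
  (forall t, ~ (a <= t <= b) -> f t = 0) -> (forall t, ~ (c <= t <= d) -> g t = 0) ->
  mu.-integrable setT (EFin \o (fun x => f x.1 * g x.2)) /\
  \int[mu]_x (f x.1 * g x.2) =
  (\int[leb]_(t in [set` `[a, b]]) f t) * (\int[leb]_(t in [set` `[c, d]]) g t).
Proof.
move=> cf cg f0 g0.
have ccfg : compactly_supp (fun x : R * R => f x.1 * g x.2).
  split.
    move=> x; apply: cvgM; apply: continuous_comp.
    - exact: cvg_fst.
    - exact: cf.
    - exact: cvg_snd.
    - exact: cg.
  exists (cbox a b c d); first exact: compact_cbox.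
  move=> x Bx; have [h|h] := pselect (a <= x.1 <= b); last by rewrite f0 ?mul0r.
  by rewrite g0 ?mulr0// => h'; apply: Bx.
have ii := compactly_supp_integrable (@measurableT _ T2) ccfg; split=> //.
have E (u : R -> R) (s t : R) : (forall x, ~ (s <= x <= t) -> u x = 0) ->
    (\int[leb]_x (u x)%:E = \int[leb]_(x in [set` `[s, t]]) (u x)%:E)%E.
  move=> u0; rewrite [RHS]integral_mkcond; apply: eq_integral => x _; rewrite patchE.
  case: ifPn => // /negP tM; rewrite u0// => h; apply: tM.
  by rewrite inE /= in_itv.
have mI (s t : R) : measurable ([set` `[s, t]] :
  set (measurableTypeR R)) by apply: measurable_itv.
have fin (u : R -> R) (s t : R) : continuous u ->
  (\int[leb]_(x in [set` `[s, t]]) (u x)%:E)%E \is a fin_num.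
  move=> cu; exact: (integrable_fin_num (mI s t) (continuous_itv_integrable s t cu)).
rewrite /Rintegral -fineM; try exact: fin.
congr fine; rewrite -(integral12_prod_meas1 ii) /fubini_F.
transitivity (\int[leb]_x ((f x)%:E * \int[leb]_(t in [set` `[c, d]]) (g t)%:E))%E.
  apply: eq_integral => x _.
  under eq_integral do rewrite /= EFinM.
  rewrite integralZl//.
    by rewrite -(E _ _ _ g0).
  apply: (integrableS (E := setT)) => //.
  have := continuous_itv_integrable c d cg; rewrite (integrable_mkcond _ (mI c d)).
  apply: eq_integrable => // t _; rewrite /= patchE; case: ifPn => //= /negP tM.
  by rewrite g0// => h; apply: tM; rewrite inE /= in_itv.
rewrite -(fineK (fin g c d cg)).
rewrite integralZr//; first by rewrite (E _ _ _ f0).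
have := continuous_itv_integrable a b cf; rewrite (integrable_mkcond _ (mI a b)).
apply: eq_integrable => // t _; rewrite /= patchE; case: ifPn => //= /negP tM.
by rewrite f0// => h; apply: tM; rewrite inE /= in_itv.
Qed.

Lemma measurable_cbox (a b c d : R) : meas2 (cbox a b c d).
Proof.
rewrite cboxE; exact: measurableX.
Qed.

Lemma leb2_cbox (c1 c2 r : R) : 0 < r ->
  mu (cbox (c1 - r) (c1 + r) (c2 - r) (c2 + r)) = (4 * r ^+ 2)%:E.
Proof.
move=> r0; rewrite cboxE; apply: (etrans (product_measure1E _ _ _ _)) => //.
have E (c : R) : (leb (`[(c - r)%R, (c + r)%R]%classic : set R) = (2 * r)%:E)%E.
  rewrite lebesgue_measure_itv/= lte_fin ifT; last by lra.
  by rewrite -EFinB; congr EFin; ring.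
transitivity ((2 * r)%:E * (2 * r)%:E)%E; first by congr (_ * _)%E; exact: E.
by rewrite -EFinM; congr EFin; ring.
Qed.

Lemma Rintegral_sq_le K (f : R * R -> R) (M c1 c2 r : R) : meas2 K -> L2 K f -> 0 < r ->
  (forall x, K x -> `|f x| <= M) ->
  (forall x, K x -> ~ cbox (c1 - r) (c1 + r) (c2 - r) (c2 + r) x -> f x = 0) ->
  \int[mu]_(x in K) f x ^+ 2 <= M ^+ 2 * (4 * r ^+ 2).
Proof.
move=> mK Lf r0 fM f0; pose B := cbox (c1 - r) (c1 + r) (c2 - r) (c2 + r).
have mB : meas2 B := measurable_cbox _ _ _ _.
have mKB : meas2 (K `&` B) by exact: measurableI.
have muB : (mu (K `&` B) <= (4 * r ^+ 2)%:E)%E.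
  by rewrite -(leb2_cbox c1 c2 r0); apply: le_measure; rewrite ?inE//; exact: subIsetr.
have fin : mu (K `&` B) \is a fin_num.
  by rewrite ge0_fin_numE// (le_lt_trans muB)// ltry.
rewrite (Rintegral_support (V := K `&` B)); last 2 first.
- exact: subIsetl.
- move=> x Kx KBx; rewrite f0 ?expr0n// => Bx; exact: KBx.
apply: (le_trans (y := \int[mu]_(x in K `&` B) (M ^+ 2))).
  apply: le_Rintegral => //.
  - by apply: integrableS (L2_sqr_integrable mK Lf) => //; exact: subIsetl.
  - apply: (bounded_box_integrable (M := M ^+ 2) (a := c1 - 2 * r) (b :=
      c1 + 2 * r) (c := c2 - 2 * r) (d := c2 + 2 * r)) => //; try lra.
    + by move=> x _; rewrite ger0_norm ?sqr_ge0.
    + by move=> x [_ [/andP[h1 h2] /andP[h3 h4]]] []; split; apply/andP; split; lra.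
  - move=> x [Kx _]; rewrite -real_normK ?num_real// ler_sqr ?nnegrE ?fM//.
    exact: le_trans (fM x Kx).
rewrite Rintegral_cst// ler_wpM2l ?sqr_ge0//.
by rewrite -lee_fin fineK.
Qed.

End Squares.

(** * Bubble functions dual to a polynomial *)

Section Bubbles.
Context {R : realType}.
Local Notation leb := (@lebesgue_measure R).
Local Notation mu := (@leb2 R).
Local Notation T2 := (measurableTypeR R * measurableTypeR R)%type.
Local Notation meas2 := (@measurable _ T2).
Local Notation mfun2 := (@measurable_fun _ _ T2 R).
Implicit Types (U K : set (R * R)).

Lemma derive1n_scale (f : R -> R) (k : R) n : smooth1 f ->
  derive1n n (fun t => k * f t) = (fun t => k * derive1n n f t).
Proof.
move=> sf; elim: n => [//|n IH]; rewrite derive1nS IH.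
have [|_ ->] := @is_derive_derive1 R (fun t => k * derive1n n f t) (fun t =>
  k * derive1n n.+1 f t); last by [].
move=> x; apply: (is_deriveZ k); rewrite derive1nS.
by apply: smooth1_is_der; exact: smooth1_dern.
Qed.

Lemma derive1n_support (f : R -> R) n (a b : R) : (forall t, ~ (a <= t <= b) -> f t = 0) ->
  forall t, ~ (a <= t <= b) -> derive1n n f t = 0.
Proof.
move=> f0; elim: n => [//|n IH] t tab.
rewrite derive1nS derive1E (@near_eq_derive R _ _ _ (cst 0)); first exact: derive_cst.
have : nbhs t (~` [set` `[a, b]]).
  apply: open_nbhs_nbhs; split; first by rewrite openC; exact: interval_closed.
  by rewrite /= in_itv.
by apply: filterS => u; rewrite /= in_itv /=; exact: IH.
Qed.

Lemma derive1n_bounded (f : R -> R) n (a b : R) : smooth1 f ->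
  (forall t, ~ (a <= t <= b) -> f t = 0) ->
  exists2 M, 0 <= M & forall t, `|derive1n n f t| <= M.
Proof.
move=> sf f0; have d0 := derive1n_support n f0.
have cd : continuous (derive1n n f) by apply: smooth1_cont; exact: smooth1_dern.
have cK : compact (derive1n n f @` `[a, b]).
  apply: continuous_compact; first exact: continuous_subspaceT.
  exact: segment_compact.
have [M [_ HM]] := compact_bounded cK.
exists (`|M| + 1) => [|t]; first by rewrite addr_ge0.
have [tab|tab] := pselect (a <= t <= b); last by rewrite d0// normr0 addr_ge0.
by apply: (HM (`|M| + 1)); [have := ler_norm M; lra|exists t; rewrite //= in_itv].
Qed.

(** A polynomial in coordinates centred at c and scaled by rho, given by its
    coefficients. *)
Definition locpoly m (rho : R) (c : R * R) (a : 'I_m.+1 * 'I_m.+1 -> R) : R * R -> R :=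
  tsum (fun i t => a i * ((t - c.1) * rho^-1) ^+ i.1)
       (fun i t => ((t - c.2) * rho^-1) ^+ i.2).

(** Expand the powers of c + rho xi in powers of the scaled coordinate xi. *)
Lemma poly2_locpoly m co (rho : R) c : 0 < rho -> exists a,
  forall x, poly2 m co x = locpoly (m := m) rho c a x.
Proof.
move=> r0; have rn0 : rho != 0 by rewrite gt_eqF.
pose P (z : R) (p : nat) : {poly R} := (z%:P + rho *: 'X) ^+ p.
have PE z p (x : R) : (p < m.+1)%N ->
    x ^+ p = \sum_(k < m.+1) (P z p)`_k * ((x - z) * rho^-1) ^+ k.
  move=> pm; rewrite -horner_coef_wide.
    rewrite /P horner_exp hornerD hornerC hornerZ hornerX; congr (_ ^+ p).
    by field.
  apply: (leq_trans (size_exp_leq _ _)); rewrite ltnS;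
    apply: leq_trans (_ : p <= m)%N => //.
  rewrite -{2}[p]mul1n leq_mul2r; apply/orP; right.
  rewrite -ltnS -[X in (_ < X)%N]/(2%N);
    apply: (@leq_ltn_trans (size (z%:P + rho *: 'X : {poly R})).-1) => //.
  have : (size (z%:P + rho *: 'X : {poly R})%R <= 2)%N.
    apply: (leq_trans (size_polyD _ _)); rewrite geq_max.
    rewrite (leq_trans (size_polyC_leq1 _))//=.
    by apply: (leq_trans (size_scale_leq _ _)); rewrite size_polyX.
  by case: (size _) => [|[|[|]]].
exists (fun i : 'I_m.+1 * 'I_m.+1 => \sum_(p < m.+1) \sum_(q < m.+1 | (p + q <= m)%N)
   co p q * (P c.1 p)`_i.1 * (P c.2 q)`_i.2) => x.
rewrite /poly2 /locpoly /tsum.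
transitivity (\sum_(p < m.+1) \sum_(i : 'I_m.+1 * 'I_m.+1) \sum_(q < m.+1 | (p + q <= m)%N)
    co p q * (P c.1 p)`_i.1 * (P c.2 q)`_i.2 *
    (((x.1 - c.1) * rho^-1) ^+ i.1 * ((x.2 - c.2) * rho^-1) ^+ i.2)); last first.
  rewrite exchange_big /=; apply: eq_bigr => i _.
  rewrite -mulrA mulr_suml; apply: eq_bigr => p _.
  by rewrite mulr_suml.
apply: eq_bigr => p _; rewrite exchange_big /=; apply: eq_bigr => q _.
rewrite (PE c.1 p x.1 (ltn_ord p)) (PE c.2 q x.2 (ltn_ord q)).
rewrite -mulrA big_distrlr /= pair_bigA /= mulr_sumr; apply: eq_bigr => -[k l] _ /=; ring.
Qed.

Definition sqsum (I : finType) (a : I -> R) : R := \sum_i a i ^+ 2.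

Lemma sqsum_ge0 (I : finType) (a : I -> R) : 0 <= sqsum a.
Proof. by apply: sumr_ge0 => i _; exact: sqr_ge0. Qed.

Lemma le_sqsum (I : finType) (a : I -> R) i : `|a i| <= Num.sqrt (sqsum a).
Proof.
rewrite -sqrtr_sqr ler_sqrt ?sqsum_ge0// /sqsum (bigD1 i)//= lerDl.
by apply: sumr_ge0 => j _; exact: sqr_ge0.
Qed.

Lemma sum_le_sqsum (I : finType) (a : I -> R) (b : I -> R) (B : R) : 0 <= B ->
  (forall i, `|b i| <= B) -> `|\sum_i a i * b i| <= #|I|%:R * B * Num.sqrt (sqsum a).
Proof.
move=> B0 bB; apply: (le_trans (ler_norm_sum _ _ _)).
apply: (le_trans (y := \sum_(i : I) B * Num.sqrt (sqsum a))).
  by apply: ler_sum => i _; rewrite normrM mulrC ler_pM// le_sqsum.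
by rewrite sumr_const -mulrA mulr_natl.
Qed.

(** v is the sum of the a i times products of dual functions in the scaled
    coordinates.  Duality gives its integral against the polynomial; the other
    bounds are pointwise bounds multiplied by the area of the support, and they
    scale as stated with C depending on m and L only. *)
Lemma dual_bubble m (L : R) : 1 <= L -> exists2 C : R, 0 < C &
  forall (rho : R) (c : R * R) (a : 'I_m.+1 * 'I_m.+1 -> R), 0 < rho ->
  exists v : R * R -> R,
  [/\ forall U, cbox (c.1 - rho) (c.1 + rho) (c.2 - rho) (c.2 + rho) `<=` U -> test_fun U v,
     \int[mu]_x (locpoly rho c a x * v x) = rho ^+ 2 * sqsum a,
     forall K s, meas2 K -> (size s <= m)%N ->
       \int[mu]_(x in K) pderivs s v x ^+ 2 <= C * (rho ^- (2 * size s) * (rho ^+ 2 *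
         sqsum a)) &
     forall K, meas2 K -> K `<=` cbox (c.1 - L * rho) (c.1 +
       L * rho) (c.2 - L * rho) (c.2 + L * rho) ->
       L2 K (locpoly rho c a) /\
       \int[mu]_(x in K) locpoly rho c a x ^+ 2 <= C * (rho ^+ 2 * sqsum a)].
Proof.
move=> L1; have [psi [spsi psi0 psiI]] := @dual_system R m.
have psi0' i t : ~ (-1 <= t <= 1) -> psi i t = 0.
  by move=> h; apply: psi0 => /andP[h1 h2]; apply: h; rewrite !ltW.
have [B [B0 HB]] : exists B : R, 0 <= B /\ forall i k t, (k <= m)%N ->
  `|derive1n k (psi i) t| <= B.
  have H (ik : 'I_m.+1 * 'I_m.+1) :
    exists M, 0 <= M /\ forall t, `|derive1n ik.2 (psi ik.1) t| <= M.
    by have [M M0 HM] := derive1n_bounded ik.2 (spsi ik.1) (psi0' ik.1); exists M.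
  have [f Hf] := choice H.
  exists (\sum_ik f ik); split; first by apply: sumr_ge0 => ik _; exact: (Hf ik).1.
  move=> i k t km; have h := (Hf (i, inord k)).2 t; rewrite /= inordK// in h.
  apply: (le_trans h).
    rewrite (bigD1 (i, inord k))//= lerDl.
    by apply: sumr_ge0 => ik _; exact: (Hf ik).1.
pose N : R := #|{: 'I_m.+1 * 'I_m.+1}|%:R.
have N0 : 0 <= N by rewrite ler0n.
pose Lam := (L ^+ m * L ^+ m).
have L0 : 0 < L by lra.
pose C := 4 * (N * B ^+ 2) ^+ 2 + 4 * (N * Lam * L) ^+ 2 + 1.
have C10 : 0 <= 4 * (N * B ^+ 2) ^+ 2 by rewrite mulr_ge0 ?sqr_ge0.
have C20 : 0 <= 4 * (N * Lam * L) ^+ 2 by rewrite mulr_ge0 ?sqr_ge0.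
have C0 : 0 < C by rewrite ltr_wpDl ?addr_ge0.
exists C => // rho c a r0.
have rn0 : rho != 0 by rewrite gt_eqF.
have rV0 : 0 < rho^-1 by rewrite invr_gt0.
have A0 := sqsum_ge0 a; set A2 := sqsum a in A0 *.
pose f (i : 'I_m.+1 * 'I_m.+1) (t : R) := a i * psi i.1 ((t - c.1) * rho^-1).
pose g (i : 'I_m.+1 * 'I_m.+1) (t : R) := psi i.2 ((t - c.2) * rho^-1).
have sg i : smooth1 (g i) by exact: smooth1_affine.
have sf i : smooth1 (f i).
  by apply: smooth1M; [exact: smooth1_cst|exact: smooth1_affine].
have out i (z t : R) : ~ (z - rho <= t <= z + rho) -> psi i ((t - z) * rho^-1) = 0.
  move=> h; apply: psi0' => /andP[]; rewrite ler_pdivlMr// ler_pdivrMr// => h1 h2.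
  by apply: h; apply/andP; split; lra.
pose v := tsum f g.
have v0 x : ~ cbox (c.1 - rho) (c.1 + rho) (c.2 - rho) (c.2 + rho) x -> v x = 0.
  move=> Bx; rewrite /v /tsum big1// => i _; rewrite /f /g.
  have [h|h] := pselect (c.1 - rho <= x.1 <= c.1 + rho); last by rewrite out ?mulr0 ?mul0r.
  by rewrite [X in _ * X]out ?mulr0// => h'; apply: Bx.
have tv U : cbox (c.1 - rho) (c.1 + rho) (c.2 - rho) (c.2 + rho) `<=` U -> test_fun U v.
  move=> BU; split; first exact: smooth_tsum.
  exists (cbox (c.1 - rho) (c.1 + rho) (c.2 - rho) (c.2 + rho)); split => //.
  exact: compact_cbox.
exists v; split => //.
- pose phi (i j : 'I_m.+1 * 'I_m.+1) (u : R) := a i * a j * (psi j.1 u * u ^+ i.1).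
  pose ga (i j : 'I_m.+1 * 'I_m.+1) (u : R) := psi j.2 u * u ^+ i.2.
  have cga (i j : 'I_m.+1 * 'I_m.+1) : continuous (ga i j).
    by move=> u; apply: cvgM; [exact: (smooth1_cont (spsi _))|exact: exprn_continuous].
  have cphi (i j : 'I_m.+1 * 'I_m.+1) : continuous (phi i j).
    move=> u; apply: cvgM; first exact: cvg_cst.
    by apply: cvgM; [exact: (smooth1_cont (spsi _))|exact: exprn_continuous].
  have caff (F : R -> R) (z : R) : continuous F ->
    continuous (fun t => F ((t - z) * rho^-1)).
    move=> cF t; apply: (@continuous_comp _ _ _ (fun t : R => (t - z) * rho^-1) F);
      last exact: cF.
    by apply: cvgM; [apply: cvgB; [exact: cvg_id|exact: cvg_cst]|exact: cvg_cst].
  have key i j := @Rintegral_prod R _ _ (c.1 - rho) (c.1 + rho) (c.2 - rho) (c.2 + rho)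
    (caff _ c.1 (cphi i j)) (caff _ c.2 (cga i j)).
  have p1 (i j : 'I_m.+1 * 'I_m.+1) (t : R) : ~ (c.1 - rho <= t <= c.1 + rho) ->
      phi i j ((t - c.1) * rho^-1) = 0.
    by move=> tn; rewrite /phi out// mul0r mulr0.
  have p2 (i j : 'I_m.+1 * 'I_m.+1) (t : R) : ~ (c.2 - rho <= t <= c.2 + rho) ->
      ga i j ((t - c.2) * rho^-1) = 0.
    by move=> tn; rewrite /ga out// mul0r.
  have ki (i j : 'I_m.+1 * 'I_m.+1) : mu.-integrable setT (EFin \o (fun x =>
    phi i j ((x.1 - c.1) * rho^-1) * ga i j ((x.2 - c.2) * rho^-1))).
    exact: (key i j (p1 i j) (p2 i j)).1.
  have kE (i j : 'I_m.+1 * 'I_m.+1) :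
    \int[mu]_x (phi i j ((x.1 - c.1) * rho^-1) * ga i j ((x.2 - c.2) * rho^-1)) =
       rho * (a i * a j * (j.1 == i.1)%:R) * (rho * (j.2 == i.2)%:R).
    rewrite (key i j (p1 i j) (p2 i j)).2.
    rewrite !Rintegral_affine//; congr (rho * _ * (rho * _)); last exact: psiI.
    rewrite /phi RintegralZl ?psiI//; apply: continuous_itv_integrable => u.
    by apply: cvgM; [exact: (smooth1_cont (spsi _))|exact: exprn_continuous].
  transitivity (\int[mu]_x \sum_i \sum_j (phi i j ((x.1 - c.1) * rho^-1) *
    ga i j ((x.2 - c.2) * rho^-1))).
    apply: eq_Rintegral => x _; rewrite /locpoly /v /tsum big_distrlr /=.
    by apply: eq_bigr => i _; apply: eq_bigr => j _; rewrite /f /g /phi /ga; ring.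
  rewrite (Rintegral_sum _ (@measurableT _ T2) _).2; last first.
    by move=> i; apply: (Rintegral_sum _ (@measurableT _ T2) _).1 => j.
  rewrite /A2 /sqsum mulr_sumr; apply: eq_bigr => i _.
  rewrite (Rintegral_sum _ (@measurableT _ T2) _).2//.
  rewrite (bigD1 i)//= kE !eqxx big1 ?addr0 ?mulr1. by rewrite !expr2; ring.
  move=> j ji; rewrite kE; have [e1|] := eqVneq j.1 i.1; last by rewrite !mulr0 mul0r.
  have [e2|] := eqVneq j.2 i.2; last by rewrite !mulr0.
  by move: ji; rewrite -pair_eqE /= /pair_eq e1 e2 !eqxx.
- move=> K s mK sm.
  have E : (count negb s + count id s = size s)%N by rewrite addnC -(count_predC id s).
  have k1 : (count negb s <= m)%N by rewrite (leq_trans _ sm)// -E leq_addr.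
  have k2 : (count id s <= m)%N by rewrite (leq_trans _ sm)// -E leq_addl.
  have dvE x : pderivs s v x = \sum_i a i *
     (rho^-1 ^+ count negb s * derive1n (count negb s) (psi i.1) ((x.1 - c.1) * rho^-1) *
      (rho^-1 ^+ count id s * derive1n (count id s) (psi i.2) ((x.2 - c.2) * rho^-1))).
    rewrite /v pderivs_tsum//; apply: eq_bigr => i _ /=.
    rewrite /f /g derive1n_scale; last exact: smooth1_affine.
    by rewrite !derive1n_affine// -?mulrA.
  pose M := N * (rho^-1 ^+ size s * B ^+ 2) * Num.sqrt A2.
  apply: (@le_trans _ _ (M ^+ 2 * (4 * rho ^+ 2))).
    apply: (@Rintegral_sq_le R K (pderivs s v) M c.1 c.2) => //.
    + exact: compactly_supp_L2 (test_fun_compactly_supp (test_fun_pderivs s (tv setT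
        (@subsetT _ _)))).
    + move=> x _; rewrite dvE; apply: sum_le_sqsum.
        by rewrite mulr_ge0 ?sqr_ge0// exprn_ge0// ltW.
      move=> i; rewrite normrM !normrM !normrX (gtr0_norm rV0) -E exprD.
      rewrite mulrACA [leRHS](_ : _ =
        rho^-1 ^+ count negb s * rho^-1 ^+ count id s * (B * B)); last by ring.
      apply: ler_wpM2l; first by rewrite mulr_ge0// exprn_ge0// ltW.
      by apply: ler_pM => //; exact: HB.
    + move=> x _; apply: pderivs_supp; last exact: v0.
      by apply: compact_closed; [exact: norm_hausdorff|exact: compact_cbox].
  have -> : M ^+ 2 * (4 * rho ^+ 2) =
    4 * (N * B ^+ 2) ^+ 2 * (rho ^- (2 * size s) * (rho ^+ 2 * A2)).
    rewrite /M !exprMn sqr_sqrtr// -exprM [(size s * 2)%N]mulnC exprVn; ring.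
  apply: ler_wpM2r; last by rewrite /C; lra.
  by rewrite mulr_ge0 ?invr_ge0 ?exprn_ge0 ?mulr_ge0 ?sqr_ge0// ltW.
- move=> K mK KB.
  pose M := N * Lam * Num.sqrt A2.
  have pM x : K x -> `|locpoly rho c a x| <= M.
    move=> /KB[/andP[x1 x2] /andP[x3 x4]].
    rewrite /locpoly /tsum; under eq_bigr do rewrite -mulrA.
    have B1 (z t : R) (k : 'I_m.+1) : z - L * rho <= t -> t <= z + L * rho ->
      `|((t - z) * rho^-1) ^+ k| <= L ^+ m.
      move=> t1 t2; rewrite normrX; apply: (le_trans (y := L ^+ k)).
        apply: lerXn2r; rewrite ?nnegrE//; first exact: ltW.
        rewrite normrM (gtr0_norm rV0) ler_pdivrMr// ler_norml.
        by apply/andP; split; lra.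
      by apply: ler_weXn2l => //; rewrite -ltnS.
    apply: sum_le_sqsum; first by rewrite mulr_ge0// exprn_ge0// ltW.
    by move=> i; rewrite normrM ler_pM// B1.
  have mp : mfun2 K (locpoly rho c a).
    apply: continuous_measurable2 => //; apply: continuous_tsum => i.
      apply: smooth1M; first exact: smooth1_cst.
      apply: (@smooth1_affine R (fun u => u ^+ i.1)).
      by have := smooth1_poly ('X^(i.1) : {poly R}); congr smooth1; apply/funext => t;
        rewrite hornerXn.
    apply: (@smooth1_affine R (fun u => u ^+ i.2)).
    by have := smooth1_poly ('X^(i.2) : {poly R}); congr smooth1; apply/funext => t;
      rewrite hornerXn.
  have Lr0 : 0 < L * rho by rewrite mulr_gt0.
  have Lp : L2 K (locpoly rho c a).
    apply: (bounded_box_L2 (M := M) (a := c.1 - 2 * (L * rho)) (b := c.1 + 2 * (L * rho))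
      (c := c.2 - 2 * (L * rho)) (d := c.2 + 2 * (L * rho))) => //; try lra.
    by move=> x /KB[/andP[h1 h2] /andP[h3 h4]] []; split; apply/andP; split; lra.
  split=> //; apply: (@le_trans _ _ (M ^+ 2 * (4 * (L * rho) ^+ 2))).
    by apply: (@Rintegral_sq_le R K (locpoly rho c a) M c.1 c.2) => // x /KB.
  have -> : M ^+ 2 * (4 * (L * rho) ^+ 2) = 4 * (N * Lam * L) ^+ 2 * (rho ^+ 2 * A2).
    by rewrite /M !exprMn sqr_sqrtr//; ring.
  apply: ler_wpM2r; last by rewrite /C; lra.
  by rewrite mulr_ge0// sqr_ge0.
Qed.

End Bubbles.

(** * The estimate on one triangle *)

Section LocalEstimate.
Context {R : realType}.
Local Notation mu := (@leb2 R).
Local Notation T2 := (measurableTypeR R * measurableTypeR R)%type.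
Local Notation meas2 := (@measurable _ T2).
Local Notation mfun2 := (@measurable_fun _ _ T2 R).
Implicit Types (U K : set (R * R)).

Lemma Rintegral_sq_ge0 K (f : R * R -> R) : 0 <= \int[mu]_(x in K) f x ^+ 2.
Proof. by apply: Rintegral_ge0 => x _; exact: sqr_ge0. Qed.

Lemma young_Rintegral K (f k : R * R -> R) (d : R) : meas2 K -> L2 K f -> L2 K k -> 0 < d ->
  `|\int[mu]_(x in K) (f x * k x)| <=
  d * \int[mu]_(x in K) k x ^+ 2 + d^-1 * \int[mu]_(x in K) f x ^+ 2.
Proof.
move=> mK Lf Lk d0.
have ifk := L2_mul_integrable mK Lf Lk; have i_f := L2_sqr_integrable mK Lf;
  have ik := L2_sqr_integrable mK Lk.
apply: (le_trans (le_normr_Rintegral mK ifk)).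
have i1 : mu.-integrable K (EFin \o (fun x => d * k x ^+ 2)).
  by have := integrableZl mK d ik; apply: eq_integrable.
have i2 : mu.-integrable K (EFin \o (fun x => d^-1 * f x ^+ 2)).
  by have := integrableZl mK d^-1 i_f; apply: eq_integrable.
rewrite -!RintegralZl// -RintegralD//.
apply: le_Rintegral => //.
- exact: integrable_norm.
- by have := integrableD mK i1 i2; apply: eq_integrable.
move=> x _; rewrite normrM -(real_normK (num_real (f x))) -(real_normK (num_real (k x))).
set F := `|f x|; set Kx := `|k x|.
have F0 : 0 <= F := normr_ge0 _; have K0 : 0 <= Kx := normr_ge0 _.
have := sqr_ge0 (d * Kx - F) => H.
rewrite -(ler_pM2l d0) (_ : d * (d * Kx ^+ 2 + d^-1 * F ^+ 2) =
  (d * Kx) ^+ 2 + F ^+ 2); last first.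
  by field; rewrite gt_eqF.
by have := mulr_ge0 (mulr_ge0 (ltW d0) F0) K0; nra.
Qed.

(** Take for phi the function v dual to the coefficients a of p in scaled
    coordinates, and let A = rho^2 |a|^2 be the integral of p v.  The tested
    equation bounds A by integrals which Young's inequality splits into small
    multiples of A and the quantities on the right-hand side; conversely A
    controls the integral of p^2. *)
Lemma local_estimate m (L : R) : 1 <= L -> exists2 C : R, 0 < C &
  forall K (rho : R) (c : R * R) (W Ga : m.-tuple bool -> R * R -> R) (g p : R * R -> R)
    (co : nat -> nat -> R), open K -> 0 < rho ->
  cbox (c.1 - rho) (c.1 + rho) (c.2 - rho) (c.2 + rho) `<=` K ->
  K `<=` cbox (c.1 - L * rho) (c.1 + L * rho) (c.2 - L * rho) (c.2 + L * rho) ->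
  (forall s, L2 K (W s)) -> (forall s, L2 K (Ga s)) -> L2 K g -> L2 K p ->
  {ae mu, forall x, K x -> p x = poly2 m co x} ->
  (forall phi, test_fun K phi ->
     \sum_(s : m.-tuple bool) \int[mu]_(x in K) (W s x * pderivs (rev s) phi x) =
     \sum_(s : m.-tuple bool) \int[mu]_(x in K) (Ga s x * pderivs (rev s) phi x) +
     \int[mu]_(x in K) (g x * phi x)) ->
  (L * rho) ^+ (2 * m) * \int[mu]_(x in K) g x ^+ 2 <=
  C * (\sum_s \int[mu]_(x in K) W s x ^+ 2 + \sum_s \int[mu]_(x in K) Ga s x ^+ 2 +
       (L * rho) ^+ (2 * m) * \int[mu]_(x in K) (g x - p x) ^+ 2).
Proof.
move=> L1; have [C0 C00 HB] := dual_bubble m L1; have L0 : 0 < L by lra.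
pose NT : R := #|{: m.-tuple bool}|%:R.
have NT0 : 0 <= NT by rewrite ler0n.
(* Q counts one term for each component of W and of Ga, with the factor L^(2m)
   that relates rho^-(2m) to (L rho)^-(2m), and one for g - p. *)
pose Q := C0 * (2 * NT * L ^+ (2 * m) + 1).
have Q0 : 0 < Q by rewrite mulr_gt0// ltr_wpDl// !mulr_ge0// exprn_ge0// ltW.
pose C := 2 * C0 * (4 * Q) + 2.
exists C; first by rewrite /C; nra.
move=> K rho c W Ga g p co oK r0 BK KB LW LG Lg Lp pE H.
have mK : meas2 K := open_measurable2 oK.
have [a aE] := @poly2_locpoly R m co rho c r0.
have [v [tv vI vD vP]] := HB rho c a r0.
have [Lq qB] := vP K mK KB.
have tvK := tv K BK.
have Lv : L2 K v := compactly_supp_L2 mK (test_fun_compactly_supp tvK).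
set A := rho ^+ 2 * sqsum a in vI vD qB.
have A0 : 0 <= A by rewrite mulr_ge0 ?sqr_ge0 ?sqsum_ge0.
have Lgp : L2 K (fun x => g x - p x) by exact: L2B.
have pq : {ae mu, forall x, K x -> p x = locpoly rho c a x}.
  by apply: ae_leb2S pE => x h Kx; rewrite h// aE.
have pv : \int[mu]_(x in K) (p x * v x) = A.
  rewrite -vI (Rintegral_test_fun _ tvK (@subsetT _ K)); apply: ae_eq_Rintegral => //.
  - by apply: measurable_funM; exact: L2_measurable.
  - by apply: measurable_funM; exact: L2_measurable.
  - by apply: ae_leb2S pq => x h Kx; rewrite h.
have p2 : \int[mu]_(x in K) p x ^+ 2 <= C0 * A.
  rewrite (ae_eq_Rintegral (g := fun x => locpoly rho c a x ^+ 2))//.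
  - by apply: measurable_funX; exact: L2_measurable.
  - by apply: measurable_funX; exact: L2_measurable.
  - by apply: ae_leb2S pq => x h Kx; rewrite h.
set D := (L * rho) ^+ (2 * m).
have D0 : 0 < D by rewrite exprn_gt0// mulr_gt0.
have rD : rho ^- (2 * m) = L ^+ (2 * m) * D^-1.
  by rewrite /D exprMn invfM mulrA divff ?mul1r// gt_eqF// exprn_gt0.
have dB (s : m.-tuple bool) :
  \int[mu]_(x in K) pderivs (rev s) v x ^+ 2 <= C0 * (L ^+ (2 * m) * D^-1 * A).
  have := vD K (rev s) mK; rewrite size_rev size_tuple leqnn => /(_ isT).
  by rewrite rD.
have vB : \int[mu]_(x in K) v x ^+ 2 <= C0 * A.
  by have := vD K [::] mK isT; rewrite /= muln0 expr0 invr1 mul1r.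
(* With this choice the multiples of A produced by Young's inequality add up to
   A / 2. *)
pose d := (2 * Q)^-1.
have d0 : 0 < d by rewrite invr_gt0 mulr_gt0.
have dV : d^-1 = 2 * Q by rewrite invrK.
have dD0 : 0 < d * D by rewrite mulr_gt0.
have Ys f (s : m.-tuple bool) : L2 K f ->
  `|\int[mu]_(x in K) (f x * pderivs (rev s) v x)| <=
   d * C0 * L ^+ (2 * m) * A + (d * D)^-1 * \int[mu]_(x in K) f x ^+ 2.
  move=> Lf; apply: (le_trans (young_Rintegral mK Lf (compactly_supp_L2 mK
    (test_fun_compactly_supp (test_fun_pderivs (rev s) tvK))) dD0)).
  rewrite lerD2r; apply: (@le_trans _ _ (d * D * (C0 * (L ^+ (2 * m) * D^-1 * A)))).
    by apply: ler_wpM2l; [exact: ltW|exact: dB].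
  by rewrite le_eqVlt; apply/orP; left; apply/eqP; field; rewrite gt_eqF.
have sumY (F : m.-tuple bool -> R * R -> R) : (forall s, L2 K (F s)) ->
   `|\sum_(s : m.-tuple bool) \int[mu]_(x in K) (F s x * pderivs (rev s) v x)| <=
   NT * (d * C0 * L ^+ (2 * m) * A) + (d * D)^-1 * \sum_s \int[mu]_(x in K) F s x ^+ 2.
  move=> LF; apply: (le_trans (ler_norm_sum _ _ _)).
  rewrite /NT mulr_natl -sumr_const mulr_sumr -big_split /=.
  by apply: ler_sum => s _; exact: Ys.
have Yg : `|\int[mu]_(x in K) ((g x - p x) * v x)| <= d * C0 * A +
  d^-1 * \int[mu]_(x in K) (g x - p x) ^+ 2.
  apply: (le_trans (young_Rintegral mK Lgp Lv d0)); rewrite lerD2r -mulrA.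
  by apply: ler_wpM2l; [exact: ltW|].
have Aid : A = \sum_(s : m.-tuple bool) \int[mu]_(x in K) (W s x * pderivs (rev s) v x)
  - \sum_(s : m.-tuple bool) \int[mu]_(x in K) (Ga s x * pderivs (rev s) v x)
  - \int[mu]_(x in K) ((g x - p x) * v x).
  rewrite (H v tvK) -pv.
  under [X in _ = _ - X]eq_Rintegral do rewrite mulrBl.
  rewrite RintegralB//; try exact: L2_mul_integrable.
  by ring.
have := sumY W LW; have := sumY Ga LG; move: Yg; move: Aid.
set IW := \sum_(s : m.-tuple bool) _; set IG := \sum_(s : m.-tuple bool) _;
  set Ig := Rintegral _ _ _.
set SW := \sum_s _; set SG := \sum_s _;
  set Sg := Rintegral mu K (fun x => (g x - p x) ^+ 2).
rewrite !ler_norml => Aid /andP[h1 h2] /andP[h3 h4] /andP[h5 h6].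
have SW0 : 0 <= SW by apply: sumr_ge0 => s _; exact: Rintegral_sq_ge0.
have SG0 : 0 <= SG by apply: sumr_ge0 => s _; exact: Rintegral_sq_ge0.
have Sg0 : 0 <= Sg by exact: Rintegral_sq_ge0.
have half : d * Q = 2^-1 by rewrite /d invfM -mulrA mulVf ?mulr1// gt_eqF.
have hA : A <= 2^-1 * A + (d * D)^-1 * (SW + SG) + d^-1 * Sg.
  have -> : 2^-1 * A = 2 * (NT * (d * C0 * L ^+ (2 * m) * A)) + d * C0 * A.
    by rewrite -half /Q; ring.
  by clear -Aid h1 h2 h3 h4 h5 h6; lra.
have hDA : D * A <= 4 * Q * (SW + SG + D * Sg).
  have : D * A <= D * (2 * ((d * D)^-1 * (SW + SG) + d^-1 * Sg)).
    by rewrite ler_pM2l//; lra.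
  rewrite invfM dV => h; apply: (le_trans h).
  by rewrite le_eqVlt; apply/orP; left; apply/eqP; field; rewrite gt_eqF.
have g2 : \int[mu]_(x in K) g x ^+ 2 <= 2 * \int[mu]_(x in K) p x ^+ 2 + 2 * Sg.
  rewrite /Sg -!RintegralZl//; try exact: L2_sqr_integrable.
  have i1 := L2_sqr_integrable mK (L2Z (Num.sqrt 2) mK Lp).
  have i2 := L2_sqr_integrable mK (L2Z (Num.sqrt 2) mK Lgp).
  have e2 : Num.sqrt (2 : R) ^+ 2 = 2 by rewrite sqr_sqrtr.
  have {}i1 : mu.-integrable K (EFin \o (fun x => 2 * p x ^+ 2)).
    by apply: eq_integrable i1 => // x _; rewrite /= exprMn e2.
  have {}i2 : mu.-integrable K (EFin \o (fun x => 2 * (g x - p x) ^+ 2)).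
    by apply: eq_integrable i2 => // x _; rewrite /= exprMn e2.
  rewrite -RintegralD//; apply: le_Rintegral => //.
  - exact: L2_sqr_integrable.
  - by have := integrableD mK i1 i2; apply: eq_integrable.
  - by move=> x _; have := sqr_ge0 (g x - 2 * p x); nra.
have : D * \int[mu]_(x in K) g x ^+ 2 <= 2 * C0 * (D * A) + 2 * (D * Sg).
  apply: (@le_trans _ _ (D * (2 * (C0 * A) + 2 * Sg))).
    by rewrite ler_pM2l//; lra.
  by rewrite le_eqVlt; apply/orP; left; apply/eqP; ring.
move=> h; apply: (le_trans h).
have DS0 : 0 <= D * Sg by rewrite mulr_ge0// ltW.
have hh : 2 * C0 * (D * A) <= 2 * C0 * (4 * Q * (SW + SG + D * Sg)).
  by rewrite ler_pM2l// mulr_gt0.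
by rewrite /C mulrDl mulrA; lra.
Qed.

End LocalEstimate.

(** * Summation over the triangles *)

Section MeshSums.
Context {R : realType}.
Local Notation mu := (@leb2 R).
Local Notation T2 := (measurableTypeR R * measurableTypeR R)%type.
Local Notation meas2 := (@measurable _ T2).
Local Notation mfun2 := (@measurable_fun _ _ T2 R).
Implicit Types (U K Om : set (R * R)).

Lemma L2_0 U : meas2 U -> L2 U (fun=> (0 : R)).
Proof.
move=> mU; apply: (bounded_box_L2 (M := 0) (a := 0) (b := 1) (c := 0) (d := 1)) => //.
by move=> x _; rewrite normr0.
Qed.

Lemma diam_ge0 K : 0 <= diam K.
Proof.
have [hs|/sup_out h] :=
  pselect (has_sup [set d | exists x y, [/\ K x, K y & d = Defs.edist x y]]);
  last by rewrite /diam h.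
have [[d dS] ub] := hs; have [x [y [_ _ dE]]] := dS.
by apply: (le_trans (y := d)); [rewrite dE sqrtr_ge0|apply: ub_le_sup].
Qed.

(** When f has no projection, [xget] returns 0, which is piecewise polynomial as
    well. *)
Lemma L2proj_pwpoly Om n (T : 'I_n -> 'I_3 -> R * R) k f : meas2 Om ->
  pwpoly Om T k (L2proj Om T k f).
Proof.
move=> mO; rewrite /L2proj; case: xgetP => [p _ [] //|_]; split; first exact: L2_0.
move=> i; exists (fun _ _ => 0); apply: aeW => x _.
by rewrite big1// => p _; rewrite big1// => q _; rewrite !mul0r.
Qed.

Lemma Rintegral_pderivs0 U K s phi : U `<=` K -> (0 < size s)%N -> test_fun U phi ->
  \int[mu]_(x in K) pderivs s phi x = 0.
Proof.
case: s => // b s UK _ tp; have tp' := test_fun_pderivs s tp.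
have [sp [Z [cZ ZU Z0]]] := test_fun_pderivs (b :: s) tp.
rewrite -(Rintegral_support (U := setT) (V := K))//; last first.
  by move=> x _ Kx; apply: Z0 => /ZU/UK.
apply: Rintegral_derive0; first exact: test_fun_compactly_supp tp'.
- by move=> x; exact: smooth_derivable tp'.1.
- exact: smooth_contD tp'.1.
Qed.

(** Weak derivatives of a test function are classical, hence supported in K. *)
Lemma Rintegral_ddot Om K m (X : tensor m) phi : open Om -> open K -> K `<=` Om ->
  L2tensor Om X -> test_fun K phi ->
  \int[mu]_(x in Om) ddot X (Dm Om phi) x =
  \sum_(s : m.-tuple bool) \int[mu]_(x in K) (X s x * pderivs (rev s) phi x).
Proof.
move=> oO oK KO LX tp; have mO : meas2 Om := open_measurable2 oO.
have h s := is_wderiv_test_fun s mO tp.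
have LD (s : m.-tuple bool) : L2 Om (wderiv Om s phi) := (wderivP (h s)).1.
rewrite /ddot (Rintegral_sum _ mO _).2; last by move=> s;
  exact: L2_mul_integrable (LX s) (LD s).
apply: eq_bigr => s _; rewrite -(Rintegral_test_fun _ (test_fun_pderivs (rev s) tp) KO).
apply: ae_eq_Rintegral => //.
- by apply: measurable_funM; [exact: L2_measurable (LX s)|exact: L2_measurable (LD s)].
- apply: measurable_funM; first exact: L2_measurable (LX s).
  exact: L2_measurable (h s).1.
- by apply: ae_leb2S (wderiv_ae oO (h s)) => x hx Ox; rewrite /Dm hx.
Qed.

Lemma L2_indic U K f : meas2 U -> meas2 K -> L2 U f -> L2 U (fun x => \1_K x * f x).
Proof.
move=> mU mK Lf; apply/L2P => //.
have mf : mfun2 U (fun x => \1_K x * f x).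
  by apply: measurable_funM; [exact: measurable_indic|exact: L2_measurable].
split=> //; have := L2_sqr_integrable mU Lf; apply: le_integrable => //.
  by apply/measurable_EFinP; exact: measurable_funX.
move=> x _ /=; rewrite lee_fin !normrX normrM exprMn -[leRHS]mul1r.
apply: ler_wpM2r; first exact: sqr_ge0.
by rewrite indicE; case: (_ \in _); rewrite ?normr1 ?normr0 ?expr1n ?expr0n.
Qed.

Lemma Rintegral_indic_sq U K f : K `<=` U ->
  \int[mu]_(x in U) (\1_K x * f x ^+ 2) = \int[mu]_(x in K) f x ^+ 2.
Proof.
move=> KU; rewrite (Rintegral_support (V := K))//; last first.
  by move=> x _ Kx; rewrite indicE memNset// mul0r.
by apply: eq_Rintegral => x Kx; rewrite indicE Kx mul1r.
Qed.

Section Mesh.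
Variables (Om : set (R * R)) (n : nat) (T : 'I_n -> 'I_3 -> R * R).
Hypothesis triT : triangulation Om T.
Hypothesis oOm : open Om.
Hypothesis lipOm : lipschitz_boundary Om.
Local Notation Kt i := ((tri T i)°).

Let mO : meas2 Om := open_measurable2 oOm.

Lemma open_tri_interior (i : 'I_n) : open (Kt i). Proof. exact: open_interior. Qed.

Lemma measurable_tri_interior (i : 'I_n) :
  meas2 (Kt i). Proof. exact: open_measurable2 (@open_tri_interior i). Qed.

Lemma tri_interior_sub (i : 'I_n) : Kt i `<=` Om.
Proof.
apply: subset_trans (lipschitz_interior_closure oOm lipOm).
apply: interiorS; have [_ <- _] := triT; by move=> x tx; exists i.
Qed.

Lemma indic_disj i j x : i != j -> Kt i x -> \1_(Kt j) x = 0 :> R.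
Proof.
by move=> ij ix; rewrite indicE memNset//; exact: (interiors_disjoint triT ij ix).
Qed.

(** At most one of the disjoint open triangles contains x. *)
Lemma mesh_sum (F : R -> R) (d : 'I_n -> R) x : F 0 = 0 ->
  F (\sum_i d i * \1_(Kt i) x) = \sum_i F (d i) * \1_(Kt i) x.
Proof.
move=> F0; have [[i ix]|nx] := pselect (exists i, Kt i x).
  have ix1 : \1_(Kt i) x = 1 :> R by rewrite indicE mem_set.
  rewrite (bigD1 i)//= [RHS](bigD1 i)//= ix1 !mulr1 big1 ?addr0; last first.
    by move=> j ji; rewrite (indic_disj _ ix) ?mulr0// eq_sym.
  by rewrite big1 ?addr0// => j ji; rewrite (indic_disj _ ix) ?mulr0// eq_sym.
have n0 j : \1_(Kt j) x = 0 :> R.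
  by rewrite indicE memNset// => jx; apply: nx; exists j.
rewrite big1; last by move=> j _; rewrite n0 mulr0.
by rewrite F0 big1// => j _; rewrite n0 mulr0.
Qed.

(** The mesh size is 0 outside the open triangles, so the skeleton does not
    contribute. *)
Lemma mesh_L2norm m f : (0 < m)%N -> L2 Om f ->
  L2norm Om (fun x => meshsize T x ^+ m * f x) ^+ 2 =
  \sum_i diam (tri T i) ^+ (2 * m) * \int[mu]_(x in Kt i) f x ^+ 2.
Proof.
move=> m0 Lf; have e0 k : (0 < k)%N -> (0 : R) ^+ k = 0 by case: k => // k _;
  rewrite expr0n.
have Lh : L2 Om (fun x => meshsize T x ^+ m * f x).
  under eq_fun.
    move=> x; rewrite /meshsize (mesh_sum (F := fun y => y ^+ m)) ?e0// mulr_suml.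
    under eq_bigr do rewrite -mulrA.
    over.
  elim: (index_enum _) => [|i r IH].
    by under eq_fun do rewrite big_nil; exact: L2_0.
  under eq_fun do rewrite big_cons.
  apply: L2D => //; apply: L2Z => //; apply: L2_indic => //; exact: measurable_tri_interior.
rewrite L2normE//.
transitivity (\int[mu]_(x in Om) \sum_i (diam (tri T i) ^+ (2 * m) * (\1_(Kt i) x *
  f x ^+ 2))).
  apply: eq_Rintegral => x _; rewrite exprMn -exprM [(m * 2)%N]mulnC.
  rewrite /meshsize (mesh_sum (F := fun y => y ^+ (2 * m))) ?e0 ?muln_gt0//.
  by rewrite mulr_suml; apply: eq_bigr => i _; rewrite -mulrA.
have ii i : mu.-integrable Om (EFin \o (fun x => \1_(Kt i) x * f x ^+ 2)).
  have := L2_mul_integrable mO (L2_indic mO (@measurable_tri_interior i) Lf) Lf.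
  by apply: eq_integrable => // x _; rewrite /= -mulrA expr2.
rewrite (Rintegral_sum _ mO _).2; last first.
  by move=> i; have := integrableZl mO (diam (tri T i) ^+ (2 * m)) (ii i);
    apply: eq_integrable.
by apply: eq_bigr => i _; rewrite RintegralZl// Rintegral_indic_sq//;
  exact: tri_interior_sub.
Qed.

Lemma mesh_sum_le f : L2 Om f ->
  \sum_i \int[mu]_(x in Kt i) f x ^+ 2 <= \int[mu]_(x in Om) f x ^+ 2.
Proof.
move=> Lf; have ii i : mu.-integrable Om (EFin \o (fun x => \1_(Kt i) x * f x ^+ 2)).
  have := L2_mul_integrable mO (L2_indic mO (@measurable_tri_interior i) Lf) Lf.
  by apply: eq_integrable => // x _; rewrite /= -mulrA expr2.
under eq_bigr do rewrite -(Rintegral_indic_sq _ (@tri_interior_sub _)).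
rewrite -(Rintegral_sum _ mO ii).2; apply: le_Rintegral => //.
- exact: (Rintegral_sum _ mO ii).1.
- exact: L2_sqr_integrable.
move=> x _; rewrite -mulr_suml -[leRHS]mul1r; apply: ler_wpM2r; first exact: sqr_ge0.
have := @mesh_sum (fun y => (y != 0)%:R) (fun=> 1) x.
rewrite /= eqxx oner_eq0 => /(_ erefl) E.
have <- : (\sum_i (1 : R) * \1_(Kt i) x != 0)%:R = \sum_i \1_(Kt i) x :> R.
  by rewrite E; apply: eq_bigr => i _; rewrite mul1r.
by case: (_ != _).
Qed.

End Mesh.

End MeshSums.

(** * Testing the equation on one triangle *)

Section LocalEquation.
Context {R : realType}.
Local Notation mu := (@leb2 R).
Local Notation T2 := (measurableTypeR R * measurableTypeR R)%type.
Local Notation meas2 := (@measurable _ T2).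
Local Notation mfun2 := (@measurable_fun _ _ T2 R).

Lemma aform_sq m K (w : R * R -> R) : open K ->
  (forall s : m.-tuple bool, L2 K (wderiv K s w)) ->
  aform m K w w = \sum_(s : m.-tuple bool) \int[mu]_(x in K) wderiv K s w x ^+ 2.
Proof.
move=> oK LW; have mK : meas2 K := open_measurable2 oK.
rewrite /aform /ddot (Rintegral_sum _ mK _).2; last by move=> s;
  exact: L2_mul_integrable (LW s) (LW s).
by apply: eq_bigr => s _; apply: eq_Rintegral => x _; rewrite expr2.
Qed.

Section Setting.
Variables (m : nat) (m_gt0 : (0 < m)%N).
Variables (Om : set (R * R)) (n : nat) (T : 'I_n -> 'I_3 -> R * R).
Hypothesis triT : triangulation Om T.
Hypothesis oOm : open Om.
Hypothesis lipOm : lipschitz_boundary Om.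
Local Notation Kt i := ((tri T i)°).

(** On the triangle the derivatives of order m of q are constant, and those of
    phi have integral zero. *)
Lemma wderiv_sub_pwpoly (u q : R * R -> R) (i : 'I_n) (s : m.-tuple bool) :
  bounded_set (Kt i) -> Hspace m Om u -> pwpoly Om T m q ->
  L2 (Kt i) (wderiv (Kt i) s (u \- q)) /\
  forall phi, test_fun (Kt i) phi ->
    \int[mu]_(x in Kt i) (wderiv (Kt i) s (u \- q) x * pderivs (rev s) phi x) =
    \int[mu]_(x in Kt i) (wderiv Om s u x * pderivs (rev s) phi x).
Proof.
move=> bK [Lu wu] [Lq pq].
have mO : meas2 Om := open_measurable2 oOm.
have oKi := @open_tri_interior R n T i; have mKi := @measurable_tri_interior R n T i.
have KOi := tri_interior_sub triT oOm lipOm (i := i).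
have [|g0 hg0] := wu s; first by rewrite size_tuple.
have hu := is_wderiv_sub mO mKi KOi (wderivP hg0).
have [c hc] := pq i.
have [y hy] := @is_wderiv_poly2 R (Kt i) m c s q oKi bK (size_tuple s) (L2_measurable
  (L2S mO mKi KOi Lq))
  (ae_leb2S (fun x h Kx => h (interior_subset Kx)) hc).
have hw := is_wderivB mKi (L2S mO mKi KOi Lu) (L2S mO mKi KOi Lq) hu hy.
split; first exact: (wderivP hw).1.
move=> phi tp; have tp' := test_fun_pderivs (rev s) tp.
have Lp := compactly_supp_L2 mKi (test_fun_compactly_supp tp').
rewrite (ae_eq_Rintegral (g := fun x =>
  (wderiv Om s u x - y) * pderivs (rev s) phi x))//; last 3 first.
- by apply: measurable_funM; [exact: L2_measurable (wderivP hw).1|exact: L2_measurable Lp].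
- by apply: measurable_funM; [exact: L2_measurable hw.1|exact: L2_measurable Lp].
- by apply: ae_leb2S (wderiv_ae oKi hw) => x h Kx; rewrite h.
under eq_Rintegral do rewrite mulrBl.
rewrite RintegralB//; [|exact: L2_mul_integrable hu.1 Lp|exact: L2_mul_integrable hy.1 Lp].
rewrite RintegralZl//; last exact: compactly_supp_integrable (test_fun_compactly_supp tp').
by rewrite (Rintegral_pderivs0 _ _ tp)// ?size_rev ?size_tuple// mulr0 subr0.
Qed.

Lemma Rintegral_sub_pw0 (q G : R * R -> R) (i : 'I_n) (s : m.-tuple bool) phi :
  L2 Om G -> pwpoly Om T 0 q -> test_fun (Kt i) phi ->
  \int[mu]_(x in Kt i) ((G x - q x) * pderivs (rev s) phi x) =
  \int[mu]_(x in Kt i) (G x * pderivs (rev s) phi x).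
Proof.
move=> LG [Lq pq] tp.
have mO : meas2 Om := open_measurable2 oOm.
have mKi := @measurable_tri_interior R n T i;
  have KOi := tri_interior_sub triT oOm lipOm (i := i).
have [c hc] := pq i; have tp' := test_fun_pderivs (rev s) tp.
have LGK := L2S mO mKi KOi LG; have LqK := L2S mO mKi KOi Lq.
have Lp := compactly_supp_L2 mKi (test_fun_compactly_supp tp').
under eq_Rintegral do rewrite mulrBl.
rewrite RintegralB//; [|exact: L2_mul_integrable|exact: L2_mul_integrable].
rewrite [X in _ - X](ae_eq_Rintegral (g := fun x =>
  c 0%N 0%N * pderivs (rev s) phi x))//; last 3 first.
- by apply: measurable_funM; exact: L2_measurable.
- by apply: measurable_funM => //; exact: L2_measurable Lp.
- apply: ae_leb2S hc => x h /interior_subset Kx; rewrite h//.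
  by rewrite big_ord1 big_mkcond big_ord1 /= !expr0 !mulr1.
rewrite RintegralZl//; last exact: compactly_supp_integrable (test_fun_compactly_supp tp').
by rewrite (Rintegral_pderivs0 _ _ tp)// ?size_rev ?size_tuple// mulr0 subr0.
Qed.

(** A test function supported in one open triangle is admissible in the global
    equation, and the point forces vanish on it. *)
Lemma local_equation (G : tensor m) g (A : {fset R * R}%fset) beta u (i : 'I_n) phi :
  L2tensor Om G -> L2 Om g ->
  (forall a, a \in A -> interior_vertex Om T a) ->
  H0space m Om u ->
  (forall v, H0space m Om v -> aform m Om u v = rhs Om G g A beta v) ->
  test_fun (Kt i) phi ->
  \sum_(s : m.-tuple bool) \int[mu]_(x in Kt i) (wderiv Om s u x * pderivs (rev s) phi x) =
  \sum_(s : m.-tuple bool) \int[mu]_(x in Kt i) (G s x * pderivs (rev s) phi x) +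
  \int[mu]_(x in Kt i) (g x * phi x).
Proof.
move=> LG Lg vA [[_ wu] _] eqn tp.
have oKi := @open_tri_interior R n T i;
  have KOi := tri_interior_sub triT oOm lipOm (i := i).
have := eqn phi (H0space_test_fun m oOm (test_fun_sub KOi tp)).
rewrite /aform /rhs !(Rintegral_ddot _ oKi KOi _ tp)//; last first.
  by move=> s; have [|g0 hg0] := wu s; [rewrite size_tuple|exact: (wderivP hg0).1].
rewrite (Rintegral_test_fun _ tp KOi) [X in _ + X]big_seq [X in _ + X]big1 ?addr0// => a aA.
have := vA a aA => va; have [Oa _] := va.
rewrite ptval_cont//; last exact: smooth_cont tp.1.
have [_ [Z [_ ZK Z0]]] := tp; rewrite Z0 ?mulr0// => /ZK.
exact: vertex_not_interior va.
Qed.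

End Setting.

End LocalEquation.

Theorem theorem6p3 (R : realType) (m : nat) (m_gt0 : (0 < m)%N) (sigma : R) :
  exists2 C : R, 0 < C &
  forall (Omega : set (R * R)) (n : nat) (T : 'I_n -> 'I_3 -> R * R)
         (Vnc : set (R * R -> R)) (Inc : (R * R -> R) -> (R * R -> R))
         (kappa : R)
         (G : tensor m) (g : R * R -> R) (A : {fset R * R}%fset)
         (beta : R * R -> R) (u : R * R -> R),
    polygonal_lipschitz_domain Omega ->
    triangulation Omega T ->
    shape_regular T sigma ->
    nc_space Omega T m Vnc ->
    0 < kappa ->
    nc_interpolation Omega T m Vnc kappa Inc ->
    L2tensor Omega G ->
    L2 Omega g ->
    (forall a, a \in A -> interior_vertex Omega T a) ->
    (m = 1%N -> A = fset0) ->
    H0space m Omega u ->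
    (forall v, H0space m Omega v ->
       aform m Omega u v = rhs Omega G g A beta v) ->
    L2norm Omega (fun x => meshsize T x ^+ m * g x)
      <= C * (normpw T m (u \- Inc u) + osc Omega T m g
              + L2normT Omega (fun s x => G s x - L2projT Omega T 0 G s x)).
Proof.
(* Each triangle contains a square of half-side diam / L. *)
pose L : R := 16 * `|sigma| + 1.
have L1 : 1 <= L by rewrite lerDr mulr_ge0.
have L0 : 0 < L by lra.
have [C C0 est] := @local_estimate R m L L1.
exists (Num.sqrt C); first by rewrite sqrtr_gt0.
move=> Om n T Vnc Inc kappa G g A beta u [oO _ _ bO [lO _]] triT shT [VP _ _ _] _ hInc LG Lg vA _ Hu eqn.
have mO : @measurable _ (measurableTypeR R * measurableTypeR R)%type Om :=
  open_measurable2 oO.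
have [VI _ _] := hInc u Hu.
have pI : pwpoly Om T m (Inc u) := VP _ VI.
pose K i := (tri T i)°.
have bK i : bounded_set (K i).
  have [M [Mr HM]] := bO; exists M; split=> // t Mt x Kx.
  exact: (HM t Mt x (tri_interior_sub triT oO lO Kx)).
pose p := L2proj Om T m g.
have pp : pwpoly Om T m p := L2proj_pwpoly T m g mO.
pose ga (s : m.-tuple bool) x := G s x - L2projT Om T 0 G s x.
have pG s : pwpoly Om T 0 (L2projT Om T 0 G s) := L2proj_pwpoly T 0 (G s) mO.
have Lga s : L2 Om (ga s) by apply: L2B => //; exact: (pG s).1.
have Lgp : L2 Om (fun x => g x - p x) by apply: L2B => //; exact: pp.1.
pose w := u \- Inc u.
have KOi i := tri_interior_sub triT oO lO (i := i).
have mKi i := @measurable_tri_interior R n T i.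
have wE i s := wderiv_sub_pwpoly m_gt0 triT oO lO s (bK i) Hu.1 pI.
pose EW i := \sum_(s : m.-tuple bool) \int[leb2]_(x in K i) wderiv (K i) s w x ^+ 2.
pose EG i := \sum_(s : m.-tuple bool) \int[leb2]_(x in K i) ga s x ^+ 2.
pose EO i := diam (tri T i) ^+ (2 * m) * \int[leb2]_(x in K i) (g x - p x) ^+ 2.
have EW0 i : 0 <= EW i by apply: sumr_ge0 => s _; exact: Rintegral_sq_ge0.
have EG0 i : 0 <= EG i by apply: sumr_ge0 => s _; exact: Rintegral_sq_ge0.
have EO0 i : 0 <= EO i by rewrite mulr_ge0 ?Rintegral_sq_ge0// exprn_ge0// diam_ge0.
have loc i : diam (tri T i) ^+ (2 * m) * \int[leb2]_(x in K i) g x ^+ 2 <= C * (EW i +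
  EG i + EO i).
  have := diam_ge0 (tri T i); rewrite le_eqVlt => /orP[/eqP <-|d0].
    rewrite expr0n muln_eq0 /= (gtn_eqF m_gt0) mul0r.
    by rewrite mulr_ge0 ?(ltW C0)// !addr_ge0.
  have [c [_ cK Kc]] := square_in_shape_regular d0 (shT i).
  rewrite -/L in cK; set rho := diam (tri T i) / L in cK.
  have Lrho : L * rho = diam (tri T i) by rewrite /rho mulrC divfK// gt_eqF.
  have r0 : 0 < rho by rewrite divr_gt0.
  have [co hco] := pp.2 i.
  have := est (K i) rho c (fun s => wderiv (K i) s w) ga g p co.
  rewrite Lrho; apply => //.
  - exact: open_interior.
  - by move=> x /interior_subset/Kc.
  - by move=> s; exact: (wE i s).1.
  - by move=> s; exact: (L2S mO (mKi i) (@KOi i) (Lga s)).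
  - exact: (L2S mO (mKi i) (@KOi i) Lg).
  - exact: (L2S mO (mKi i) (@KOi i) pp.1).
  - by apply: ae_leb2S hco => x h /interior_subset Kx; rewrite h.
  - move=> phi tp.
    under eq_bigr do rewrite (wE i _).2//.
    under [X in _ = X + _]eq_bigr do rewrite (Rintegral_sub_pw0 m_gt0 triT oO lO _
      (LG _) (pG _) tp).
    exact: (local_equation triT oO lO LG Lg vA Hu eqn tp).
set W := normpw _ _ _; set O := osc _ _ _ _; set Ga := L2normT _ _.
have W2 : W ^+ 2 = \sum_i EW i.
  have apwE : apw T m w w = \sum_i EW i.
    apply: eq_bigr => i _; apply: aform_sq; first exact: open_interior.
    by move=> s; exact: (wE i s).1.
  by rewrite /W /normpw apwE sqr_sqrtr// sumr_ge0.
have O2 : O ^+ 2 = \sum_i EO i by rewrite /O /osc (mesh_L2norm triT oO lO m_gt0 Lgp).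
have G2 : \sum_i EG i <= Ga ^+ 2.
  rewrite /Ga /L2normT sqr_sqrtr; last by apply: sumr_ge0 => s _; exact: sqr_ge0.
  rewrite /EG exchange_big /=; apply: ler_sum => s _.
  rewrite (L2normE mO (Lga s)); exact: (mesh_sum_le triT oO lO (Lga s)).
have W0 : 0 <= W by exact: sqrtr_ge0.
have O0 : 0 <= O by exact: L2norm_ge0.
have G0 : 0 <= Ga by exact: sqrtr_ge0.
have S0 : 0 <= W + O + Ga by rewrite !addr_ge0.
rewrite -ler_sqr ?nnegrE ?L2norm_ge0 ?mulr_ge0 ?sqrtr_ge0//.
rewrite exprMn sqr_sqrtr ?(ltW C0)// (mesh_L2norm triT oO lO m_gt0 Lg).
apply: (@le_trans _ _ (C * (W ^+ 2 + Ga ^+ 2 + O ^+ 2))).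
  apply: (@le_trans _ _ (C * (\sum_i EW i + \sum_i EG i + \sum_i EO i))).
    by rewrite -!big_split /= mulr_sumr; apply: ler_sum => i _; exact: loc.
  by rewrite ler_pM2l// W2 O2 lerD2r lerD2l.
rewrite ler_pM2l//.
by have := mulr_ge0 W0 O0; have := mulr_ge0 W0 G0; have := mulr_ge0 O0 G0; nra.
Qed.
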